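(* Let $S$ be a set of positive diameter in a normed plane with unit ball $\mathbf{B}$. \begin{itemize} \item If $S$ is not a set of unique completion, or $S$ does not satisfy the supporting line property, then for every positive integer $k$, $a_k(S)=2k$. \item If $S$ is a set of unique completion that satisfies the supporting line property, and the completion of $S$ is not a Reuleaux polygon, then for every positive integer $k$, $a_k(S)=2k+1$. \end{itemize}
   Context: A normed plane is $\mathbb{R}^2$ equipped with a norm, with closed unit ball $\mathbf{B}$; diameters are taken with respect to this norm. A bounded set $C$ is complete if no set of the same diameter properly contains $C$. A set $S$ is a set of unique completion if there is a unique complete set $C$ containing $S$ and having the same diameter as $S$; this $C$ is the completion of $S$. A set $S$ of unique completion, with completion $C$, satisfies the supporting line property if for any pair of parallel supporting lines of $C$, $S$ has a point on at least one of them. A complete set $C$ of diameter $d>0$ is a Reuleaux polygon if it is the intersection of finitely many translates of $d\mathbf{B}$. For a set $S$ of diameter $d>0$, the $k$-fold Borsuk number $a_k(S)$ is the smallest cardinality of a family $\mathcal{F}$ of subsets of $S$, of diameters strictly less than $d$, such that every point of $S$ belongs to at least $k$ members of $\mathcal{F}$.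
   Formalization: In the first bullet the supporting line property is required to fail for the closure of S, not only for S: the open Euclidean disc meets no supporting line of its completion, yet its a_1 is 3. Families may repeat members, and a pair of parallel supporting lines means two distinct lines. *)

(* Defs.v *)
From HB Require Import structures.
From mathcomp Require Import all_boot all_order all_algebra.
From mathcomp Require Import all_classical all_reals all_analysis.

Set Implicit Arguments.
Unset Strict Implicit.
Unset Printing Implicit Defensive.

Import Order.TTheory GRing.Theory Num.Theory.
Import numFieldNormedType.Exports.

Local Open Scope classical_set_scope.
Local Open Scope ring_scope.

(* The norm of the plane is an arbitrary function on 'rV[R]_2, unrelated to the
   canonical (sup) norm `|x| of that type; both induce the same topology. *)
Definition is_norm (R : realType) (N : 'rV[R]_2 -> R) : Prop :=
  [/\ forall x y, N (x + y) <= N x + N y,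
      forall a x, N (a *: x) = `|a| * N x
    & forall x, N x = 0 -> x = 0].

Definition unit_ball (R : realType) (N : 'rV[R]_2 -> R) : set 'rV[R]_2 :=
  [set x | N x <= 1].

Definition norm_bounded (R : realType) (N : 'rV[R]_2 -> R)
    (S : set 'rV[R]_2) : Prop :=
  exists M : R, forall x, S x -> N x <= M.

(* As a real supremum this is meaningful for bounded sets only (sup is 0 on sets
   that are empty or not bounded above); in particular diam set0 = 0. *)
Definition diam (R : realType) (N : 'rV[R]_2 -> R) (S : set 'rV[R]_2) : R :=
  sup [set r | exists x y, [/\ S x, S y & r = N (x - y)]].

Definition complete_body (R : realType) (N : 'rV[R]_2 -> R)
    (C : set 'rV[R]_2) : Prop :=
  norm_bounded N C /\
  forall D, norm_bounded N D -> diam N D = diam N C -> ~ (C `<` D).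

(* C is the completion of S: the only complete set of the same diameter
   containing S. *)
Definition completion (R : realType) (N : 'rV[R]_2 -> R)
    (S C : set 'rV[R]_2) : Prop :=
  unique (fun D => [/\ complete_body N D, S `<=` D & diam N D = diam N S]) C.

Definition unique_completion (R : realType) (N : 'rV[R]_2 -> R)
    (S : set 'rV[R]_2) : Prop :=
  exists C, completion N S C.

Definition line (R : realType) (a : 'cV[R]_2) (c : R) : set 'rV[R]_2 :=
  [set x | (x *m a) 0 0 = c].

Definition supporting_line (R : realType) (C L : set 'rV[R]_2) : Prop :=
  exists a c, [/\ a != 0, L = line a c, C `&` L !=set0
                & forall x, C x -> (x *m a) 0 0 <= c].

Definition parallel (R : realType) (L1 L2 : set 'rV[R]_2) : Prop :=
  exists a c1 c2, [/\ a != 0, L1 = line a c1 & L2 = line a c2].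

(* The two lines of a pair are distinct. This property is meant for closed sets:
   an open Euclidean disc has the closed disc as its unique completion and meets
   none of the supporting lines, yet, exactly like the closed disc, it is not a
   union of two sets of smaller diameter. Hence a failure of the property is
   significant only when it persists for closure S. *)
Definition supporting_line_property (R : realType) (N : 'rV[R]_2 -> R)
    (S : set 'rV[R]_2) : Prop :=
  exists C, completion N S C /\
    forall L1 L2, supporting_line C L1 -> supporting_line C L2 ->
      parallel L1 L2 -> L1 <> L2 -> S `&` L1 !=set0 \/ S `&` L2 !=set0.

Definition reuleaux_polygon (R : realType) (N : 'rV[R]_2 -> R)
    (C : set 'rV[R]_2) : Prop :=
  [/\ complete_body N C, 0 < diam N C
    & exists P : set 'rV[R]_2, finite_set P /\
        C = \bigcap_(p in P) [set p + diam N C *: b | b in unit_ball N]].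

(* Families are indexed, so a member may be repeated: a pair of points has only
   its two singletons as nonempty subsets of smaller diameter. *)
Definition kfold_cover (R : realType) (N : 'rV[R]_2 -> R) (k : nat)
    (S : set 'rV[R]_2) (m : nat) (F : 'I_m -> set 'rV[R]_2) : Prop :=
  (forall i, F i `<=` S /\ diam N (F i) < diam N S) /\
  (forall x, S x -> (k <= #|[pred i | x \in F i]|)%N).

(* a_k(S) = m. *)
Definition is_borsuk_number (R : realType) (N : 'rV[R]_2 -> R) (k : nat)
    (S : set 'rV[R]_2) (m : nat) : Prop :=
  (exists F : 'I_m -> set 'rV[R]_2, kfold_cover N k S F) /\
  (forall m' (F : 'I_m' -> set 'rV[R]_2), kfold_cover N k S F -> (m <= m')%N).

(* Main.v *)
(* Let C be the completion of S and d its diameter. A complete set in the plane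
   has constant width, so diametral pairs of C lie on opposite parallel
   supporting lines, and conversely.

   2k sets suffice: if S misses the faces of C in two opposite directions, then
   the line through a point of either face, slightly displaced if it supports C,
   separates every diametral pair of S; hence S is a union of two sets of
   smaller diameter. If S is not of unique completion, then some completion has
   this property: take z, c within d of all of S but further than d apart,
   shrink the segment zc to length d and complete S together with the new
   endpoints.

   2k sets are not enough: for 2k sets the two points of a diametral pair have
   complementary label sets. By unique completion every boundary point of C is
   at distance d from a point of S, so a fixed label defines a closed set X of
   directions with X and -X covering the circle, hence meeting, which is absurd.

   2k + 1 sets suffice: if C is not a Reuleaux polygon, then by compactness there
   is a direction v such that no point of C has both v and a direction close to v
   on a given side as normals, and likewise for -v. This gives arbitrarily long
   sequences of directions, no two consecutive ones being normal at a common
   point. Cutting the boundary at 2k + 1 of them, with alternating signs, gives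
   2k + 1 arcs, unions of k consecutive pieces, without diametral pairs; they
   cover the boundary k times, and the cones over them from an interior point
   cover C k times. *)

Require Import Defs.
From HB Require Import structures.
From mathcomp Require Import all_boot all_order all_algebra.
From mathcomp Require Import all_classical all_reals all_analysis.
From mathcomp Require Import finmap zify ring lra.
Import Order.TTheory GRing.Theory Num.Theory.
Import numFieldNormedType.Exports.
Local Open Scope classical_set_scope.
Local Open Scope ring_scope.

Set Implicit Arguments.
Unset Strict Implicit.
Unset Printing Implicit Defensive.

(** * Linear algebra of the plane *)

Section Coordinates.
Context {R : realType}.
Local Notation V := 'rV[R]_2.
Implicit Types u v w x y z : V.

(* Linear functionals of the plane are represented by vectors through [dot];
   [det] gives the orientation of a pair. *)
Definition dot u x : R := u 0 0 * x 0 0 + u 0 1 * x 0 1.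
Definition det u x : R := u 0 0 * x 0 1 - u 0 1 * x 0 0.

Lemma plane_eq x y : x 0 0 = y 0 0 -> x 0 1 = y 0 1 -> x = y.
Proof.
move=> h0 h1; apply/rowP => -[[|[|//]] hi].
  by rewrite (_ : Ordinal hi = 0)//; exact: val_inj.
by rewrite (_ : Ordinal hi = 1)//; exact: val_inj.
Qed.

Lemma dotDl u v x : dot (u + v) x = dot u x + dot v x.
Proof. by rewrite /dot !mxE; ring. Qed.
Lemma dotDr u x y : dot u (x + y) = dot u x + dot u y.
Proof. by rewrite /dot !mxE; ring. Qed.
Lemma dotNl u x : dot (- u) x = - dot u x.
Proof. by rewrite /dot !mxE; ring. Qed.
Lemma dotNr u x : dot u (- x) = - dot u x.
Proof. by rewrite /dot !mxE; ring. Qed.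
Lemma dotZl a u x : dot (a *: u) x = a * dot u x.
Proof. by rewrite /dot !mxE; ring. Qed.
Lemma dotZr a u x : dot u (a *: x) = a * dot u x.
Proof. by rewrite /dot !mxE; ring. Qed.
Lemma dot0r u : dot u 0 = 0.
Proof. by rewrite /dot !mxE; ring. Qed.
Definition dotE := (dotDl, dotDr, dotNl, dotNr, dotZl, dotZr, dot0r).

Lemma detDl u v x : det (u + v) x = det u x + det v x.
Proof. by rewrite /det !mxE; ring. Qed.
Lemma detDr u x y : det u (x + y) = det u x + det u y.
Proof. by rewrite /det !mxE; ring. Qed.
Lemma detNl u x : det (- u) x = - det u x.
Proof. by rewrite /det !mxE; ring. Qed.
Lemma detNr u x : det u (- x) = - det u x.
Proof. by rewrite /det !mxE; ring. Qed.
Lemma detZl a u x : det (a *: u) x = a * det u x.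
Proof. by rewrite /det !mxE; ring. Qed.
Lemma detZr a u x : det u (a *: x) = a * det u x.
Proof. by rewrite /det !mxE; ring. Qed.
Lemma det_id u : det u u = 0.
Proof. by rewrite /det; ring. Qed.
Definition detE := (detDl, detDr, detNl, detNr, detZl, detZr, det_id).

Lemma detC u v : det u v = - det v u.
Proof. by rewrite /det; ring. Qed.

Lemma dot_gt0 u : u != 0 -> 0 < dot u u.
Proof.
move=> u0; rewrite lt_def addr_ge0 ?andbT; last 2 first.
- by rewrite -expr2 sqr_ge0.
- by rewrite -expr2 sqr_ge0.
apply: contra_neq u0; rewrite /dot -!expr2 => h.
have [] := paddr_eq0 (sqr_ge0 (u 0 0)) (sqr_ge0 (u 0 1)).
rewrite h eqxx => /esym/andP[]; rewrite !sqrf_eq0 => /eqP h0 /eqP h1.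
by apply: plane_eq; rewrite mxE.
Qed.

Lemma cramer u v x : det u v *: x = det x v *: u + det u x *: v.
Proof. by apply: plane_eq; rewrite /det !mxE; ring. Qed.

Lemma dot_inj u v x : det u v != 0 -> dot u x = 0 -> dot v x = 0 -> x = 0.
Proof.
move=> uv hu hv.
have e0 : det u v * x 0 0 = v 0 1 * dot u x - u 0 1 * dot v x.
  by rewrite /det /dot; ring.
have e1 : det u v * x 0 1 = u 0 0 * dot v x - v 0 0 * dot u x.
  by rewrite /det /dot; ring.
apply: plane_eq; rewrite mxE; apply: (mulfI uv).
  by rewrite e0 hu hv; ring.
by rewrite e1 hu hv; ring.
Qed.

Lemma det_eq0 u v : u != 0 -> det u v = 0 -> exists c, v = c *: u.
Proof.
move=> /dot_gt0 u0 h; exists (dot u v / dot u u).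
apply: (@scalerI _ _ (dot u u)); first by rewrite gt_eqF.
rewrite scalerA mulrC divfK ?gt_eqF//.
have := h; rewrite /det => h'.
apply: plane_eq; rewrite /dot !mxE; apply/eqP; rewrite -subr_eq0; apply/eqP.
  transitivity (- u 0 1 * (u 0 0 * v 0 1 - u 0 1 * v 0 0)); first by ring.
  by rewrite h' mulr0.
transitivity (u 0 0 * (u 0 0 * v 0 1 - u 0 1 * v 0 0)); first by ring.
by rewrite h' mulr0.
Qed.

Lemma det_neq0l u v : det u v != 0 -> u != 0.
Proof. by apply: contra_neq => ->; rewrite /det !mxE; ring. Qed.

Lemma exists_det_gt0 u : u != 0 -> exists w, 0 < det u w.
Proof.
move=> /dot_gt0; rewrite /dot => u0.
exists (\row_(i < 2) if i == 0 then - u 0 1 else u 0 0).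
by rewrite /det !mxE /=; lra.
Qed.

Lemma dot_perp u v : u != 0 -> (forall w, dot u w = 0 -> dot v w = 0) ->
  exists c, v = c *: u.
Proof.
move=> u0 h; apply: det_eq0 => //.
have := h (\row_(i < 2) if i == 0 then - u 0 1 else u 0 0).
rewrite /dot /det !mxE /= => <-; by ring.
Qed.

Lemma continuous_dot u : continuous (dot u).
Proof.
move=> x; apply: (@continuousD _ _ _ (fun y : V => u 0 0 * y 0 0)
  (fun y : V => u 0 1 * y 0 1)); apply: continuousM;
  by [exact: cst_continuous|exact: coord_continuous].
Qed.

Lemma ler_dot u x : `|dot u x| <= 2 * `|u| * `|x|.
Proof.
have hc (v : V) i : `|v 0 i| <= `|v| by rewrite [leRHS]/Num.norm/= mx_normrE;
  exact: (@le_bigmax _ _ _ 0 (fun ij => `|v ij.1 ij.2|) (0, i)).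
rewrite (le_trans (ler_normD _ _))// !normrM mulr_natl mulr2n mulrDl.
by apply: lerD; apply: ler_pM.
Qed.

End Coordinates.

Lemma compact_max {T : topologicalType} {R : realType} (f : T -> R) (A : set T) :
  A !=set0 -> compact A -> continuous f ->
  exists2 c, A c & forall t, A t -> f t <= f c.
Proof.
move=> A0 cA cf.
have [c cA' h] := compact_EVT_max A0 cA (continuous_subspaceT cf).
exists c; first exact: set_mem.
by move=> t At; apply: h; exact: mem_set.
Qed.

(** * Norms and diameters *)

Section NormedPlane.
Context {R : realType} {N : 'rV[R]_2 -> R} (hN : is_norm N).
Local Notation V := 'rV[R]_2.
Implicit Types (u v w x y z c : V) (A B C S T : set V) (r d e : R).

Lemma normD x y : N (x + y) <= N x + N y.
Proof. by case: hN. Qed.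

Lemma normZ a x : N (a *: x) = `|a| * N x.
Proof. by case: hN. Qed.

Lemma norm_eq0 x : N x = 0 -> x = 0.
Proof. by case: hN => _ _; exact. Qed.

Lemma norm0 : N 0 = 0.
Proof. by rewrite -(scale0r 0) normZ normr0 mul0r. Qed.

Lemma normN x : N (- x) = N x.
Proof. by rewrite -scaleN1r normZ normrN1 mul1r. Qed.

Lemma norm_ge0 x : 0 <= N x.
Proof. by have := normD x (- x); rewrite subrr norm0 normN; lra. Qed.

Lemma normB x y : N (x - y) = N (y - x).
Proof. by rewrite -normN opprB. Qed.

Lemma norm_triangle y x z : N (x - z) <= N (x - y) + N (y - z).
Proof. by rewrite -{1}(subrK y x) -addrA normD. Qed.

Lemma normZ_ge0 a x : 0 <= a -> N (a *: x) = a * N x.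
Proof. by move=> a0; rewrite normZ ger0_norm. Qed.

Lemma norm_gt0 x : x != 0 -> 0 < N x.
Proof.
by move=> x0; rewrite lt_def norm_ge0 andbT; apply: contra_neq x0; exact: norm_eq0.
Qed.

Lemma norm_le_sup_norm : exists2 M, 0 < M & forall x, N x <= M * `|x|.
Proof.
pose e1 : V := \row_i (i == 0)%:R; pose e2 : V := \row_i (i == 1)%:R.
exists (N e1 + N e2 + 1) => [|x].
  by rewrite ltr_wpDl// addr_ge0// norm_ge0.
have hc i : `|x 0 i| <= `|x|.
  by rewrite [leRHS]/Num.norm/= mx_normrE;
    exact: (@le_bigmax _ _ _ 0 (fun ij => `|x ij.1 ij.2|) (0, i)).
have {1}-> : x = x 0 0 *: e1 + x 0 1 *: e2.
  by apply: plane_eq; rewrite !mxE /= ?mulr1 ?mulr0 ?addr0 ?add0r.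
apply: le_trans (normD _ _) _; rewrite !normZ.
have := ler_wpM2r (norm_ge0 e1) (hc 0); have := ler_wpM2r (norm_ge0 e2) (hc 1).
by have := normr_ge0 x; lra.
Qed.

Lemma continuous_norm : continuous N.
Proof.
have [M M0 hM] := norm_le_sup_norm.
move=> x; apply/(@cvgrPdist_lt _ _ _ (nbhs x)) => e e0; apply/nbhs_ballP.
exists (e / M) => /=; first exact: divr_gt0.
move=> y; rewrite -ball_normE /= ltr_pdivlMr// mulrC => hxy.
have := le_lt_trans (hM _) hxy.
have := norm_triangle y x 0; have := norm_triangle x y 0.
by rewrite !subr0 (normB y x) ltr_norml => *; apply/andP; split; lra.
Qed.

(** [N] is continuous and nonzero on the compact unit sphere of the sup norm, so it has a positive
    minimum there; by homogeneity its inverse is the constant. *)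
Lemma sup_norm_le_norm : exists2 M, 0 < M & forall x, `|x| <= M * N x.
Proof.
pose sph : set V := [set x | `|x| = 1].
have csph : compact sph.
  apply: bounded_closed_compact.
    exists 1; split=> [|M M1 x /= ->]; [exact: num_real|exact: ltW].
  rewrite (_ : sph = (@Num.norm R V) @^-1` [set 1]).
    apply: preimage_closed; last exact: closed_eq.
    by move=> x _; exact: norm_continuous.
  by [].
pose e1 : V := \row_i 1.
have e1n : e1 != 0.
  by apply/eqP => /rowP/(_ 0); rewrite !mxE => /eqP; rewrite oner_eq0.
have unit x : x != 0 -> sph (`|x|^-1 *: x).
  move=> x0; rewrite /sph /= normrZ normfV normr_id mulVf// normr_eq0 //.
have cN : continuous (fun x => - N x).
  by move=> x; apply: continuousN; exact: continuous_norm.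
have [|c sc hc] := compact_max _ csph cN; first by eexists; exact: unit e1n.
have c0 : c != 0.
  by apply/eqP => c0; move: sc; rewrite c0 /sph /= normr0 => /esym/eqP; rewrite oner_eq0.
have Nc := norm_gt0 c0.
exists (N c)^-1 => [|x]; first by rewrite invr_gt0.
have [->|x0] := eqVneq x 0; first by rewrite normr0 norm0 mulr0.
have := hc _ (unit _ x0); rewrite lerN2 normZ normfV normr_id.
have x0' : 0 < `|x| by rewrite normr_gt0.
by rewrite ler_pdivlMl// mulrC -ler_pdivlMl.
Qed.

(** [closure] refers to the topology of the sup norm; the comparison of norms allows it to be tested
    with [N]. *)
Lemma closure_norm A x e : closure A x -> 0 < e ->
  exists a, A a /\ N (x - a) < e.
Proof.
move=> cA e0.
have o : nbhs x [set y | N (x - y) < e].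
  have [M M0 hM] := norm_le_sup_norm.
  apply/nbhs_ballP; exists (e / M) => /=; first exact: divr_gt0.
  move=> y; rewrite -ball_normE /= ltr_pdivlMr// mulrC; exact: le_lt_trans.
by have [a [Aa ha]] := cA _ o; exists a.
Qed.

Lemma closed_norm A :
  (forall x, (forall e, 0 < e -> exists a, A a /\ N (x - a) < e) -> A x) ->
  closed A.
Proof.
by move=> h x cA; apply: h => e; exact: closure_norm.
Qed.

Lemma compact_norm A : closed A -> norm_bounded N A -> compact A.
Proof.
move=> cA [M hM]; apply: bounded_closed_compact => //.
have [K K0 hK] := sup_norm_le_norm.
exists (K * M); split=> [|L KL x Ax]; first exact: num_real.
apply: le_trans (ltW KL); apply: le_trans (hK _) _.
by rewrite ler_pM2l//; exact: hM.
Qed.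

Lemma norm_bounded_compact A : compact A -> norm_bounded N A.
Proof.
move=> /compact_bounded[M [_ hM]]; have [K K0 hK] := norm_le_sup_norm.
exists (K * (M + 1)) => x Ax; apply: le_trans (hK _) _.
by rewrite ler_pM2l//; apply: hM => //; rewrite ltrDl.
Qed.

Lemma norm_boundedS A B : A `<=` B -> norm_bounded N B -> norm_bounded N A.
Proof. by move=> AB [M hM]; exists M => x /AB; exact: hM. Qed.

Lemma norm_bounded_closure A : norm_bounded N A -> norm_bounded N (closure A).
Proof.
move=> [M hM]; exists (M + 1) => x /closure_norm/(_ ltr01)[a [/hM ? ?]].
by have := norm_triangle a x 0; rewrite !subr0; lra.
Qed.

Lemma compact_closure_bounded A : norm_bounded N A -> compact (closure A).
Proof.
by move=> /norm_bounded_closure; apply: compact_norm; exact: closed_closure.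
Qed.

Lemma closed_ball_norm c r : closed [set x | N (x - c) <= r].
Proof.
apply: closed_norm => x h /=; rewrite leNgt; apply/negP => h1.
have [|a [/= ? ?]] := h (N (x - c) - r); first by rewrite subr_gt0.
by have := norm_triangle a x c; lra.
Qed.

Lemma compact_ball_norm c r : compact [set x | N (x - c) <= r].
Proof.
apply: compact_norm; first exact: closed_ball_norm.
by exists (r + N c) => x /= h; have := norm_triangle c x 0; rewrite !subr0; lra.
Qed.

Lemma continuous_normB c : continuous (fun x => N (x - c)).
Proof.
move=> x; apply: (@continuous_comp _ _ _ (fun x => x - c) N).
  by apply: continuousB; [exact: cvg_id|exact: cst_continuous].
exact: continuous_norm.
Qed.

Lemma continuous_norm_sub : continuous (fun p : V * V => N (p.1 - p.2)).
Proof.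
move=> p; apply: (@continuous_comp _ _ _ (fun p : V * V => p.1 - p.2) N).
  exact: sub_continuous.
exact: continuous_norm.
Qed.

(* Hahn-Banach in the plane: the norming functional of [x] is extended along a
   single further vector [e], on which its value [c] has to satisfy
   [s N(x) - N(s x - e) <= c <= N(s x + e) - s N(x)] for all [s]. *)
Lemma norming_functional x :
  exists w, (forall y, dot w y <= N y) /\ dot w x = N x.
Proof.
have [->|x0] := eqVneq x 0.
  exists 0; split=> [y|]; last by rewrite /dot !mxE norm0; ring.
  by rewrite /dot !mxE !mul0r addr0 norm_ge0.
have [e De] := exists_det_gt0 x0.
have hs s t : s * N x - N (s *: x - e) <= N (t *: x + e) - t * N x.
  have := normD (s *: x - e) (t *: x + e).
  rewrite addrACA addNr addr0 -scalerDl normZ.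
  have := ler_wpM2r (norm_ge0 x) (ler_norm (s + t)).
  by rewrite mulrDl; lra.
pose E : set R := range (fun s => s * N x - N (s *: x - e)).
pose c := sup E.
have E0 : E !=set0 by eexists; exists 0.
have lec s : s * N x - N (s *: x - e) <= c.
  apply: ub_le_sup; last by exists s.
  by exists (N (0 *: x + e) - 0 * N x) => _ [t _ <-]; exact: hs.
have gec t : c <= N (t *: x + e) - t * N x.
  by apply: ge_sup => // _ [s _ <-]; exact: hs.
pose f y := (det x e)^-1 * (det y e * N x + det x y * c).
(* These two vectors represent the functionals [det y e] and [det x y] of [y]. *)
pose p : V := \row_i if i == 0 then e 0 1 else - e 0 0.
pose q : V := \row_i if i == 0 then - x 0 1 else x 0 0.
exists ((det x e)^-1 *: (N x *: p + c *: q)).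
have fE y : dot ((det x e)^-1 *: (N x *: p + c *: q)) y = f y.
  by rewrite !dotE /f /p /q /dot /det !mxE /=; ring.
split=> [y|]; last by rewrite fE /f det_id mul0r addr0 mulKf ?gt_eqF.
rewrite fE /f ler_pdivrMl//.
have -> : det x e * N y = N (det x e *: y) by rewrite normZ gtr0_norm.
(* Dividing by the absolute value of the coefficient [det x y] of [e] reduces the bound to [lec] if
   this coefficient is negative and to [gec] if it is positive. *)
rewrite cramer; case: (ltrgtP (det x y) 0) => h.
- have h' : 0 < - det x y by rewrite oppr_gt0.
  pose a := det y e / - det x y; have := ler_wpM2l (ltW h') (lec a).
  have -> : det y e *: x + det x y *: e = - det x y *: (a *: x - e).
    by rewrite scalerBr scalerA /a mulrCA divff ?gt_eqF// mulr1 scaleNr opprK.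
  rewrite (normZ_ge0 _ (ltW h')) mulrBr mulrA /a mulrCA divff ?gt_eqF// mulr1; lra.
- pose a := det y e / det x y; have := ler_wpM2l (ltW h) (gec a).
  have -> : det y e *: x + det x y *: e = det x y *: (a *: x + e).
    by rewrite scalerDr scalerA /a mulrCA divff ?gt_eqF// mulr1.
  rewrite (normZ_ge0 _ (ltW h)) mulrBr mulrA /a mulrCA divff ?gt_eqF// mulr1; lra.
- rewrite h mul0r addr0 scale0r addr0 normZ.
  by apply: ler_wpM2r; [exact: norm_ge0|exact: ler_norm].
Qed.

Lemma compact_argmax u A : A !=set0 -> compact A ->
  exists2 a, A a & forall b, A b -> dot u b <= dot u a.
Proof. by move=> A0 cA; apply: compact_max => //; exact: continuous_dot. Qed.

Lemma ball_argmax u r : 0 <= r ->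
  exists2 b, N b <= r & forall b', N b' <= r -> dot u b' <= dot u b.
Proof.
move=> r0; have [|b /=] := @compact_argmax u _ _ (@compact_ball_norm 0 r).
  by exists 0; rewrite /= subrr norm0.
by rewrite subr0 => Nb h; exists b => // b' Nb'; apply: h; rewrite /= subr0.
Qed.

Let dset S := [set r | exists x y, [/\ S x, S y & r = N (x - y)]].

Lemma diam_has_ubound S : norm_bounded N S -> has_ubound (dset S).
Proof.
move=> [M hM]; exists (M + M) => _ [x [y [Sx Sy ->]]].
by have := normD x (- y); rewrite normN; have := hM _ Sx; have := hM _ Sy; lra.
Qed.

Lemma le_diam S x y : norm_bounded N S -> S x -> S y -> N (x - y) <= diam N S.
Proof.
by move=> bS Sx Sy; apply: ub_le_sup; [exact: diam_has_ubound|exists x, y].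
Qed.

Lemma diam_le S r : 0 <= r -> (forall x y, S x -> S y -> N (x - y) <= r) ->
  diam N S <= r.
Proof.
move=> r0 h; have [S0|/set0P[x Sx]] := eqVneq S set0.
  rewrite /diam (_ : [set _ | _] = set0) ?sup0//.
  by apply/seteqP; split=> // t [x [y [+ _ _]]]; rewrite S0.
apply: ge_sup; first by exists (N (x - x)), x, x.
by move=> _ [a [b [Sa Sb ->]]]; exact: h.
Qed.

Lemma diam_le_bounded S r : (forall x y, S x -> S y -> N (x - y) <= r) ->
  norm_bounded N S.
Proof.
move=> h; have [->|/set0P[a Sa]] := eqVneq S set0; first by exists 0.
exists (r + N a) => x Sx; have := norm_triangle a x 0; rewrite !subr0.
by have := h _ _ Sx Sa; lra.
Qed.

Lemma diam_ge0 S : norm_bounded N S -> 0 <= diam N S.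
Proof.
move=> bS; have [S0|/set0P[x Sx]] := eqVneq S set0.
  rewrite /diam (_ : [set _ | _] = set0) ?sup0//.
  by apply/seteqP; split=> // t [x [y [+ _ _]]]; rewrite S0.
by apply: le_trans (le_diam bS Sx Sx); exact: norm_ge0.
Qed.

Lemma diamS S T : S `<=` T -> norm_bounded N T -> diam N S <= diam N T.
Proof.
move=> ST bT; apply: diam_le => [|x y /ST ? /ST ?]; first exact: diam_ge0.
exact: le_diam.
Qed.

Lemma diam_nonempty S : 0 < diam N S -> S !=set0.
Proof.
move=> d0; apply/set0P/eqP => S0; move: d0.
rewrite /diam (_ : [set _ | _] = set0) ?sup0 ?ltxx//.
by apply/seteqP; split=> // t [x [y [+ _ _]]]; rewrite S0.
Qed.

Lemma lt_diam S r : 0 <= r -> r < diam N S ->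
  exists x y, [/\ S x, S y & r < N (x - y)].
Proof.
move=> r0 h; apply: contrapT => H; move: h; apply/negP; rewrite -leNgt.
apply: diam_le => // x y Sx Sy; rewrite leNgt; apply/negP => h.
by apply: H; exists x, y.
Qed.

Lemma diam_attained S : compact S -> S !=set0 ->
  exists x y, [/\ S x, S y & N (x - y) = diam N S].
Proof.
move=> cS [s Ss].
have [|[x y] /= [Sx Sy] h] := compact_max _ (compact_setX cS cS) continuous_norm_sub.
  by exists (s, s).
exists x, y; split=> //; apply/le_anti; rewrite le_diam//=; last exact: norm_bounded_compact.
apply: diam_le => [|a b Sa Sb]; first exact: norm_ge0.
exact: (h (a, b)).
Qed.

(** A compact set attains its diameter, so the strict bound survives the supremum; [0 < r] covers
    the empty set, of diameter 0. *)
Lemma diam_lt S r : compact S -> 0 < r ->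
  (forall x y, S x -> S y -> N (x - y) < r) -> diam N S < r.
Proof.
move=> cS r0 h; have [S0|/set0P S0] := eqVneq S set0.
  apply: le_lt_trans r0; apply: diam_le => // x y; by rewrite S0.
by have [x [y [Sx Sy <-]]] := diam_attained cS S0; exact: h.
Qed.

Lemma diam_closure S : norm_bounded N S -> diam N (closure S) = diam N S.
Proof.
move=> bS; apply/le_anti/andP; split; last first.
  by apply: diamS; [exact: subset_closure|exact: norm_bounded_closure].
apply: diam_le => [|x y Sx Sy]; first exact: diam_ge0.
apply/ler_addgt0Pr => e e0.
have e2 : 0 < e / 2 by rewrite divr_gt0.
have [a [Sa xa]] := closure_norm Sx e2; have [b [Sb yb]] := closure_norm Sy e2.
have := le_diam bS Sa Sb; have := norm_triangle a x y; have := norm_triangle b a y.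
by rewrite (normB b y); lra.
Qed.

End NormedPlane.

(** * Faces and complete sets *)

Section Faces.
Context {R : realType}.
Local Notation V := 'rV[R]_2.
Implicit Types (u v w x y z c : V) (C : set V).

(** The points of [C] with outer normal [u]; for [u = 0] this is all of [C]. *)
Definition face C u : set V :=
  [set x | C x /\ forall c, C c -> dot u c <= dot u x].

(** The normals at a fixed point form a convex cone. *)
Lemma faceD C u v x a b : 0 <= a -> 0 <= b ->
  face C u x -> face C v x -> face C (a *: u + b *: v) x.
Proof.
move=> a0 b0 [Cx hu] [_ hv]; split=> // c Cc; rewrite !dotE.
by apply: lerD; apply: ler_wpM2l => //; [exact: hu|exact: hv].
Qed.

Lemma faceZ C u x a : 0 <= a -> face C u x -> face C (a *: u) x.
Proof. by move=> a0 h; have := faceD a0 (lexx 0) h h; rewrite scale0r addr0. Qed.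

Lemma face_dot_eq C u x y : face C u x -> face C u y -> dot u x = dot u y.
Proof. by move=> [Cx hx] [Cy hy]; apply/le_anti; rewrite hx// hy. Qed.

Lemma face_eq C u v x y : det u v != 0 -> face C u x -> face C v x ->
  face C u y -> face C v y -> x = y.
Proof.
move=> uv ux vx uy vy; apply/subr0_eq; apply: (dot_inj uv).
  by rewrite dotDr dotNr (face_dot_eq ux uy) subrr.
by rewrite dotDr dotNr (face_dot_eq vx vy) subrr.
Qed.

Lemma det_of_perp p u w : p != 0 -> dot u p = 0 -> dot w p = 0 -> det u w = 0.
Proof.
move=> p0 hu hw; have [//|uw] := eqVneq (det u w) 0.
by have := dot_inj uw hu hw => /eqP; rewrite (negPf p0).
Qed.

Lemma det_of_perp2 u x y : u != 0 -> dot u x = 0 -> dot u y = 0 -> det x y = 0.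
Proof.
have dotC a b : dot a b = dot b a :> R by rewrite /dot; ring.
by move=> u0; rewrite !(dotC u); exact: det_of_perp.
Qed.

(** A functional that is maximal at the midpoint of a segment in [C] is constant along it. Hence [u]
    and [w] are both perpendicular to [x - y]. *)
Lemma face_midpoint C u w x y : x != y -> u != 0 -> face C u x -> face C u y ->
  face C w (2^-1 *: (x + y)) -> exists a, w = a *: u.
Proof.
move=> xy u0 ux uy [_ hw].
have := hw _ (proj1 ux); have := hw _ (proj1 uy); have := face_dot_eq ux uy.
rewrite !dotE => e1 e2 e3; apply: det_eq0 => //.
apply: (@det_of_perp (x - y)); first by rewrite subr_eq0.
  by rewrite !dotE; lra.
by rewrite !dotE; lra.
Qed.

Lemma le0_of_affine (a b e : R) : 0 < e ->
  (forall t, 0 < t < e -> a + t * b <= 0) -> a <= 0.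
Proof.
move=> e0 h; rewrite leNgt; apply/negP => a0.
have b1 : 0 < `|b| + 1 by rewrite ltr_wpDl.
pose t := Num.min (e / 2) (a / 2 / (`|b| + 1)).
have t0 : 0 < t by rewrite lt_min !divr_gt0.
have te : t <= e / 2 by rewrite ge_min lexx.
have tb : t * (`|b| + 1) <= a / 2.
  by rewrite -ler_pdivlMr// ge_min lexx orbT.
have ht : a + t * b <= 0 by apply: h; rewrite t0 /=; lra.
have := ler_norm (- b); rewrite normrN => hb.
have : t * - b <= t * `|b| by rewrite ler_pM2l.
by rewrite mulrN; lra.
Qed.

Lemma face_limit C v w x e : 0 < e ->
  (forall t, 0 < t < e -> face C (v + t *: w) x) -> face C v x.
Proof.
move=> e0 h; have [Cx _] : face C (v + (e / 2) *: w) x by apply: h; lra.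
split=> // c Cc; rewrite -subr_le0.
apply: (@le0_of_affine _ (dot w c - dot w x) _ e0) => t te.
by have [_ /(_ _ Cc)] := h _ te; rewrite !dotE; lra.
Qed.

(** The normals [v + t *: w] at [x] with [t >= 0] form a closed interval, bounded because a point of
    [C] where [w] exceeds its value at [x] limits [t]; [e] is its supremum. *)
Lemma face_last C v w x : face C v x -> ~ face C w x ->
  exists e : R, [/\ 0 <= e, face C (v + e *: w) x &
    forall t, e < t -> ~ face C (v + t *: w) x].
Proof.
move=> fx nw; have Cx := fx.1.
have [c Cc wc] : exists2 c, C c & dot w x < dot w c.
  apply: contrapT => h; apply: nw; split=> // c Cc.
  by rewrite leNgt; apply/negP => ?; apply: h; exists c.
pose E : set R := [set t | 0 <= t /\ face C (v + t *: w) x].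
have E0 : E 0 by split=> //; rewrite scale0r addr0.
have Eface t b : E t -> C b -> t * dot w (b - x) <= dot v (x - b).
  by move=> [_ [_ h]] /h; rewrite !dotE; lra.
have Eub b : C b -> dot w x < dot w b -> ubound E (dot v (x - b) / dot w (b - x)).
  move=> Cb wb t /Eface/(_ Cb); rewrite ler_pdivlMr//.
  by rewrite dotDr dotNr subr_gt0.
have hE : has_ubound E by eexists; exact: Eub wc.
have leE t : E t -> t <= sup E by move=> Et; exact: ub_le_sup.
have e0 : 0 <= sup E by exact: leE.
exists (sup E); split=> // [|t et ft]; last first.
  by have : E t by [split=> //; lra]; move=> /leE; lra.
split=> // b Cb; have [wb|wb] := ltP (dot w x) (dot w b).
  have : sup E <= dot v (x - b) / dot w (b - x).
    by apply: ge_sup; [exists 0|exact: Eub].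
  rewrite ler_pdivlMr; last by rewrite dotDr dotNr subr_gt0.
  by rewrite !dotE; lra.
have : sup E * dot w b <= sup E * dot w x by apply: ler_wpM2l.
by have := fx.2 _ Cb; rewrite !dotE; lra.
Qed.

End Faces.

(** * Existence of complete supersets and absorption of points *)

Section CompleteBodies.
Context {R : realType} {N : 'rV[R]_2 -> R} (hN : is_norm N).
Local Notation V := 'rV[R]_2.
Implicit Types (u v w x y z c : V) (A B C S T : set V).

(** Adjoining such a point would not increase the diameter. *)
Lemma complete_absorb C z : complete_body N C ->
  (forall c, C c -> N (z - c) <= diam N C) -> C z.
Proof.
move=> [bC hC] hz; apply: contrapT => nCz; have d0 := diam_ge0 hN bC.
have hD x y : (C `|` [set z]) x -> (C `|` [set z]) y -> N (x - y) <= diam N C.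
  move=> [Cx|->] [Cy|->]; first exact: le_diam.
  - by rewrite (normB hN); exact: hz.
  - exact: hz.
  - by rewrite subrr norm0.
have bD := diam_le_bounded hN hD.
apply: (hC _ bD) => [|].
  by apply/le_anti; rewrite diam_le//= diamS//; exact: subsetUl.
by split; [exact: subsetUl|move=> /(_ z)/= h; apply/nCz/h; right].
Qed.

(** Zorn's lemma on the sets that can be adjoined to [A] without increasing the diameter. The union
    with [A] is built into the property so that the empty chain satisfies it too. *)
Lemma exists_complete A : norm_bounded N A ->
  exists C, [/\ complete_body N C, A `<=` C & diam N C = diam N A].
Proof.
move=> bA; have d0 := diam_ge0 hN bA.
pose P B := forall x y, (A `|` B) x -> (A `|` B) y -> N (x - y) <= diam N A.
have [F FP Ftot|B [PB maxB]] := @Zorn_bigcup V P.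
  move=> x y [Ax|[X FX Xx]] [Ay|[Y FY Yy]]; first exact: le_diam.
  - by apply: (FP _ FY); [left|right].
  - by apply: (FP _ FX); [right|left].
  - have [XY|YX] := Ftot _ _ FX FY.
      by apply: (FP _ FY); right => //; exact: XY.
    by apply: (FP _ FX); right => //; exact: YX.
have bC : norm_bounded N (A `|` B) by exact: diam_le_bounded PB.
have dC : diam N (A `|` B) = diam N A.
  by apply/le_anti; rewrite (diam_le d0 PB)/= diamS//; exact: subsetUl.
exists (A `|` B); split; [|exact: subsetUl|exact: dC].
split=> // D bD dD [CD nDC].
have AD : A `<=` D by move=> x Ax; apply: CD; left.
apply: (maxB D).
  by split=> [x Bx|DB]; [apply: CD; right|apply: nDC => x /DB; right].
rewrite /P ((setUidPr _ _).2 AD) -dC -dD => x y Dx Dy.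
exact: le_diam.
Qed.

(** A complete set of the same diameter around [S] and [z] is also one around [S], hence equal to
    [C]. *)
Lemma completion_absorb S C z : completion N S C -> norm_bounded N S ->
  (forall s, S s -> N (z - s) <= diam N S) -> C z.
Proof.
move=> [[_ SC _] uC] bS hz; have d0 := diam_ge0 hN bS.
have hD x y : (S `|` [set z]) x -> (S `|` [set z]) y -> N (x - y) <= diam N S.
  move=> [Cx|->] [Cy|->]; first exact: le_diam.
  - by rewrite (normB hN); exact: hz.
  - exact: hz.
  - by rewrite subrr norm0.
have bD := diam_le_bounded hN hD.
have dD : diam N (S `|` [set z]) = diam N S.
  by apply/le_anti; rewrite diam_le//= diamS//; exact: subsetUl.
have [D [cD SD eD]] := exists_complete bD.
rewrite (uC D); first by apply: SD; right.
by split=> //; [move=> x Sx; apply: SD; left|rewrite eD].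
Qed.

End CompleteBodies.

(* [T] spans the body [C] of diameter [d]: [C] is the intersection of the balls
   of radius [d] centred at the points of [T]. *)
Record spans (R : realType) (N : 'rV[R]_2 -> R) (d : R) (T C : set 'rV[R]_2) :=
  Spans {
    spans_compact : compact T;
    spans_sub : T `<=` C;
    spans_diam : forall x y, C x -> C y -> N (x - y) <= d;
    spans_absorb : forall z, (forall s, T s -> N (z - s) <= d) -> C z }.

Section Spans.
Context {R : realType} {N : 'rV[R]_2 -> R} (hN : is_norm N).
Local Notation V := 'rV[R]_2.
Implicit Types (u v w x y z c : V) (A B C S T : set V) (d : R).

Lemma complete_closed C : complete_body N C -> closed C.
Proof.
move=> cC; have bC := cC.1; apply: (closed_norm hN) => x hx.
apply: (complete_absorb hN cC) => c Cc; apply/ler_addgt0Pr => e /hx[a [Ca ?]].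
by have := norm_triangle hN a x c; have := le_diam hN bC Ca Cc; lra.
Qed.

Lemma complete_spans C : complete_body N C -> spans N (diam N C) C C.
Proof.
move=> cC; have bC := cC.1; split=> //.
- by apply: (compact_norm hN) => //; exact: complete_closed.
- by move=> x y; exact: le_diam.
- by move=> z; exact: complete_absorb.
Qed.

(** Uniqueness of the completion makes the points of [S] alone determine [C]; the closure supplies
    compactness. *)
Lemma completion_spans S C : norm_bounded N S -> completion N S C ->
  spans N (diam N S) (closure S) C.
Proof.
move=> bS comp; have [[cC SC eC] _] := comp.
have sC := complete_spans cC.
split; first exact: (compact_closure_bounded hN).
- by move=> x Sx; apply: (complete_closed cC); exact: closureS SC _ Sx.
- by rewrite -eC; exact: spans_diam sC.
- move=> z hz; apply: (completion_absorb hN comp) => // s Ss.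
  by apply: hz; exact: subset_closure.
Qed.

Section Body.
Context {C T : set V} {d : R} (d0 : 0 < d) (sC : spans N d T C).

(* If [x] were at distance less than [d] from every point of [T], then [C] would
   contain a neighbourhood of [x]. *)
Lemma face_partner u x : u != 0 -> face C u x ->
  exists s v, [/\ T s, v != 0, N (x - s) = d, face C v x & face C (- v) s] /\
    forall b, N b <= d -> dot v b <= dot v (x - s).
Proof.
move=> u0 [Cx hx]; have Nu := norm_gt0 hN u0; have uu := dot_gt0 u0.
have abs t : 0 < t -> ~ C (x + t *: u).
  move=> t0 /hx; rewrite !dotE; have := mulr_gt0 t0 uu; lra.
have T0 : T !=set0.
  apply/set0P/eqP => T0; apply: (abs 1 ltr01); apply: (spans_absorb sC) => s.
  by rewrite T0.
have [s Ts hs] := compact_max T0 (spans_compact sC) (@continuous_normB _ _ hN x).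
have xs : N (x - s) = d.
  apply/le_anti; rewrite (spans_diam sC)//=; last exact: (spans_sub sC).
  rewrite leNgt; apply/negP => lt.
  have t0 : 0 < (d - N (x - s)) / N u by rewrite divr_gt0// subr_gt0.
  apply: (abs _ t0); apply: (spans_absorb sC) => r Tr.
  have := hs _ Tr; rewrite !(normB hN _ x) => hr.
  rewrite addrAC; apply: le_trans (normD hN _ _) _.
  by rewrite (normZ_ge0 hN _ (ltW t0)) divfK ?gt_eqF//; lra.
have [v [hv hvx]] := norming_functional hN (x - s).
exists s, v; have Cs := spans_sub sC Ts; split; first split=> //.
- apply/eqP => v0; move: hvx; rewrite xs v0 /dot !mxE !mul0r addr0.
  by move=> e; move: d0; rewrite -e ltxx.
- split=> // c Cc; have := hv (c - s); have := spans_diam sC Cc Cs.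
  by move: hvx; rewrite xs !dotE; lra.
- split=> // c Cc; have := hv (x - c); have := spans_diam sC Cx Cc.
  by move: hvx; rewrite xs !dotE; lra.
- by move=> b Nb; rewrite hvx xs; apply: le_trans (hv _) Nb.
Qed.

End Body.

Lemma spans_convex C T d a b x y : spans N d T C -> 0 <= a -> 0 <= b ->
  a + b = 1 -> C x -> C y -> C (a *: x + b *: y).
Proof.
move=> sC a0 b0 ab Cx Cy; apply: (spans_absorb sC) => s /(spans_sub sC) Cs.
have -> : a *: x + b *: y - s = a *: (x - s) + b *: (y - s).
  by rewrite -{1}(scale1r s) -ab scalerDl !scalerBr opprD addrACA.
apply: le_trans (normD hN _ _) _; rewrite !(normZ_ge0 hN)//.
have := ler_wpM2l a0 (spans_diam sC Cx Cs).
have := ler_wpM2l b0 (spans_diam sC Cy Cs).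
have : a * d + b * d = d by rewrite -mulrDl ab mul1r.
lra.
Qed.

Lemma spans_midpoint C T d x y : spans N d T C -> C x -> C y ->
  C (2^-1 *: (x + y)).
Proof.
move=> sC Cx Cy; rewrite scalerDr; apply: spans_convex sC _ _ _ _ _ => //.
by lra.
Qed.

(* A body contained in a line is a segment, and its midpoint is interior. *)
Lemma face_antipodal C d u x : 0 < d -> spans N d C C -> diam N C = d ->
  face C u x -> face C (- u) x -> u = 0.
Proof.
move=> d0 sC dC [Cx hx] [_ hx']; apply/eqP; apply: contraT => u0.
have flat c : C c -> dot u c = dot u x.
  by move=> Cc; have := hx _ Cc; have := hx' _ Cc; rewrite !dotE; lra.
have C0 : C !=set0 by exists x.
have [a [b [Ca Cb ab]]] := diam_attained hN (spans_compact sC) C0.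
rewrite dC in ab.
have ba0 : b - a != 0.
  by rewrite subr_eq0; apply/eqP => e; move: d0; rewrite -ab e subrr norm0 ?ltxx.
have Nu := norm_gt0 hN u0.
(* Every point of the segment is within [d / 2] of its midpoint, and the displacement along [u] has
   length [d / 2]. *)
pose z := 2^-1 *: (a + b) + (d / 2 / N u) *: u.
suff Cz : C z.
  have := flat _ Cz; rewrite /z !dotE (flat _ Ca) (flat _ Cb) => h.
  have := mulr_gt0 (divr_gt0 (divr_gt0 d0 (ltr0Sn R 1)) Nu) (dot_gt0 u0).
  by lra.
apply: (spans_absorb sC) => c Cc.
have [t ct] : exists t, c - a = t *: (b - a).
  apply: det_eq0 => //; apply: det_of_perp2 u0 _ _; rewrite !dotE.
    by rewrite (flat _ Ca) (flat _ Cb) subrr.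
  by rewrite (flat _ Ca) (flat _ Cc) subrr.
have Nba : N (b - a) = d by rewrite (normB hN).
have t1 : `|t| <= 1.
  have := spans_diam sC Cc Ca; rewrite ct normZ// Nba.
  by rewrite -{2}(mul1r d) ler_pM2r.
have t2 : `|t - 1| <= 1.
  have := spans_diam sC Cc Cb.
  rewrite -(subrK a c) -addrA -(opprB b a) ct -{2}(scale1r (b - a)) -scalerBl normZ// Nba.
  by rewrite -{2}(mul1r d) ler_pM2r.
have t3 : `|2^-1 - t| <= 2^-1.
  by move: t1 t2; rewrite !ler_norml => /andP[? ?] /andP[? ?]; apply/andP; split; lra.
have -> : z - c = (2^-1 - t) *: (b - a) + (d / 2 / N u) *: u.
  have -> : c = t *: (b - a) + a by rewrite -ct subrK.
  by rewrite /z; move: (d / 2 / N u) => k; apply: plane_eq; rewrite !mxE; lra.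
apply: le_trans (normD hN _ _) _; rewrite !normZ// Nba.
rewrite (ger0_norm (ltW (divr_gt0 (divr_gt0 d0 (ltr0Sn R 1)) Nu))).
rewrite divfK ?gt_eqF//; have := ler_wpM2r (ltW d0) t3; lra.
Qed.

End Spans.

(** * Complete sets have constant width *)

Section ConstantWidth.
Context {R : realType} {N : 'rV[R]_2 -> R} (hN : is_norm N).
Local Notation V := 'rV[R]_2.
Implicit Types (u v w x y z c : V).
Context {C : set V} {d : R} (d0 : 0 < d) (sC : spans N d C C) (dC : diam N C = d).

(* The width of [C] in the direction [v] is at least, hence equal to, that of
   a ball of radius [d / 2]. *)
Definition wide v := exists x y, [/\ C x, C y &
  forall b, N b <= d -> dot v b <= dot v (x - y)].

Let C0 : C !=set0.
Proof. by apply: (@diam_nonempty _ N); rewrite dC. Qed.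

Lemma wideZ a v : wide v -> wide (a *: v).
Proof.
move=> [x [y [Cx Cy h]]]; have [a0|a0] := leP 0 a.
  exists x, y; split=> // b /h; rewrite !(dotZl a); exact: ler_wpM2l.
exists y, x; split=> // b Nb; have := h (- b); rewrite (normN hN) => /(_ Nb).
by rewrite !(dotZl a) ler_nM2l// !dotE; lra.
Qed.

Lemma wide_face u x : u != 0 -> face C u x ->
  exists w, [/\ w != 0, wide w & face C w x].
Proof.
move=> u0 fx; have [s [v [[Cs v0 _ fvx _] hv]]] := face_partner hN d0 sC u0 fx.
by exists v; split=> //; exists x, s; split=> //; case: fx.
Qed.

(** That [v] is not wide is a strict inequality between its maxima over the differences of points of
    [C] and over the ball, so small perturbations preserve it. *)
Lemma not_wide_open v w : ~ wide v ->
  exists2 e, 0 < e & forall t, 0 <= t < e -> ~ wide (v + t *: w).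
Proof.
move=> nw.
have cC := spans_compact sC.
have [b0 Nb0 hb0] := ball_argmax hN v (ltW d0).
have [x0 Cx0 hx0] := compact_argmax v C0 cC.
have [y0 Cy0 hy0] := compact_argmax (- v) C0 cC.
have d2 : 0 <= 2 * d by rewrite mulr_ge0// ltW.
(* The radius [2 * d] accommodates [x - y - b0], a difference of two vectors of norm at most [d]. *)
have [k _ hk] := ball_argmax hN w d2.
have gap : 0 < dot v b0 - dot v (x0 - y0).
  rewrite subr_gt0 ltNge; apply/negP => h; apply: nw.
  by exists x0, y0; split=> // b /hb0 h'; exact: le_trans h' h.
have k0 : 0 <= dot w k.
  by have := hk 0; rewrite (norm0 hN) dot0r => ->.
have k1 : 0 < dot w k + 1 by lra.
exists ((dot v b0 - dot v (x0 - y0)) / (dot w k + 1)); first exact: divr_gt0.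
move=> t /andP[t0]; rewrite ltr_pdivlMr// => te [x [y [Cx Cy h]]].
have Nz : N (x - y - b0) <= 2 * d.
  have := normD hN (x - y) (- b0); rewrite (normN hN).
  by have := spans_diam sC Cx Cy; lra.
have h1 : t * dot w (x - y - b0) <= t * dot w k by apply: ler_wpM2l => //; exact: hk.
have := h _ Nb0; have := hx0 _ Cx; have := hy0 _ Cy.
by move: te h1; rewrite !dotE; lra.
Qed.

(** The midpoint of two points of the face has a wide normal by [wide_face]; if the points differ,
    this normal is a multiple of [v]. *)
Lemma not_wide_face_eq v x y : v != 0 -> ~ wide v -> face C v x -> face C v y ->
  x = y.
Proof.
move=> v0 nw fx fy; apply/eqP; apply: contraT => xy; exfalso; apply: nw.
have fm : face C v (2^-1 *: (x + y)).
  split; first by apply: (spans_midpoint hN sC); [case: fx|case: fy].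
  move=> c Cc; have := fx.2 _ Cc; have := fy.2 _ Cc; rewrite !dotE; lra.
have [w [w0 ww fw]] := wide_face v0 fm.
have [a aE] := face_midpoint xy v0 fx fy fw.
have a0 : a != 0 by apply: contra_neq w0 => a0; rewrite aE a0 scale0r.
have -> : v = a^-1 *: w by rewrite aE scalerA mulVf// scale1r.
exact: wideZ.
Qed.

(* The arc of the sphere of radius [d] around [x] between two points of [C]
   opposite to [x] lies in [C]. *)
Lemma wide_between v1 v2 x l m : 0 < l -> 0 < m -> det v1 v2 != 0 ->
  face C v1 x -> face C v2 x -> wide v1 -> wide v2 -> wide (l *: v1 + m *: v2).
Proof.
move=> l0 m0 D12 f1 f2.
have opp v : face C v x -> wide v ->
    exists y, [/\ N (x - y) <= d, C y &
      forall b, N b <= d -> dot v b <= dot v (x - y)].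
  move=> [Cx fx] [p [q [Cp Cq h]]]; exists q; split=> //; first exact: (spans_diam sC).
  by move=> b /h; have := fx _ Cp; rewrite !dotE; lra.
move=> /(opp _ f1)[y1 [N1 C1 h1]] /(opp _ f2)[y2 [N2 C2 h2]].
have [Z NZ hZ] := ball_argmax hN (l *: v1 + m *: v2) (ltW d0).
have Cx := f1.1.
suff CZ : C (x - Z).
  by exists x, (x - Z); split=> // b /hZ; rewrite subKr.
apply: (spans_absorb sC) => c Cc; rewrite (normB hN) leNgt; apply/negP => far.
have [w [hw hwc]] := norming_functional hN (c - (x - Z)).
have [a1 [a2 wE]] : exists a1 a2, w = a1 *: v1 + a2 *: v2.
  exists (det w v2 / det v1 v2), (det v1 w / det v1 v2).
  apply: (@scalerI _ _ (det v1 v2)) => //.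
  by rewrite cramer scalerDr !scalerA !(mulrC (det v1 v2)) !divfK.
have wZ1 : dot w (x - y1) < dot w Z.
  have := hw (c - y1); have := spans_diam sC Cc C1; move: hwc; rewrite !dotE; lra.
have wZ2 : dot w (x - y2) < dot w Z.
  have := hw (c - y2); have := spans_diam sC Cc C2; move: hwc; rewrite !dotE; lra.
have Z1 := h1 _ NZ; have Z2 := h2 _ NZ; have Y1 := hZ _ N1; have Y2 := hZ _ N2.
have wc : 0 < dot w (c - x).
  have := hw Z; move: hwc; rewrite !dotE; lra.
have c1 := f1.2 _ Cc; have c2 := f2.2 _ Cc.
move: wZ1 wZ2 Z1 Z2 Y1 Y2 wc c1 c2; rewrite wE !dotE.
set X1 := dot v1 x; set X2 := dot v2 x; set P11 := dot v1 y1; set P12 := dot v2 y1.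
set P21 := dot v1 y2; set P22 := dot v2 y2; set A := dot v1 Z; set B := dot v2 Z.
set G1 := dot v1 c; set G2 := dot v2 c => wZ1 wZ2 Z1 Z2 Y1 Y2 wc c1 c2.
(* [p] and [q] are how far [Z] falls short of the maxima of [v1] and [v2] over
   the ball, attained at [x - y1] and [x - y2]; [r] and [s] are its gains over
   [x - y1] in [v2] and over [x - y2] in [v1]. *)
pose p := X1 - P11 - A; pose r := B - (X2 - P12).
pose q := X2 - P22 - B; pose s := A - (X1 - P21).
have p0 : 0 <= p by rewrite /p; lra.
have q0 : 0 <= q by rewrite /q; lra.
have rp : l * p <= m * r by move: Y1; rewrite /p /r; lra.
have sq : m * q <= l * s by move: Y2; rewrite /q /s; lra.
have e1 : a1 * p < a2 * r by move: wZ1; rewrite /p /r; lra.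
have e2 : a2 * q < a1 * s by move: wZ2; rewrite /q /s; lra.
have r0 : 0 <= r by rewrite -(pmulr_rge0 _ m0); apply: le_trans rp; apply: mulr_ge0 => //; exact: ltW.
have s0 : 0 <= s by rewrite -(pmulr_rge0 _ l0); apply: le_trans sq; apply: mulr_ge0 => //; exact: ltW.
(* Coefficients of different signs contradict [e1] or [e2]; two negative ones give both
   [a1 * m < a2 * l] and its converse; two nonnegative ones are excluded by [wc], since [x]
   maximizes [v1] and [v2]. *)
have [a1n|a1p] := ltP a1 0.
  have a2n : a2 < 0.
    rewrite ltNge; apply/negP => a2p.
    have := mulr_ge0 a2p q0; have : a1 * s <= 0 by rewrite nmulr_rle0.
    lra.
  have : m * (a1 * p) < a2 * (m * r) by rewrite (mulrCA a2) ltr_pM2l.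
  have : l * (a2 * q) < a1 * (l * s) by rewrite (mulrCA a1) ltr_pM2l.
  have : a2 * (m * r) <= a2 * (l * p) by rewrite ler_nM2l.
  have : a1 * (l * s) <= a1 * (m * q) by rewrite ler_nM2l.
  move=> h3 h4 h5 h6.
  have k1 : (a1 * m) * p < (a2 * l) * p by lra.
  have k2 : (a2 * l) * q < (a1 * m) * q by lra.
  have pp : 0 < p by rewrite lt_def p0 andbT; apply/eqP => pE; move: k1; rewrite pE !mulr0 ltxx.
  have qp : 0 < q by rewrite lt_def q0 andbT; apply/eqP => qE; move: k2; rewrite qE !mulr0 ltxx.
  by move: k1 k2; rewrite !ltr_pM2r//; lra.
have [a2n|a2p] := ltP a2 0.
  have := mulr_ge0 a1p p0; have : a2 * r <= 0 by rewrite nmulr_rle0.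
  by lra.
have : a1 * (G1 - X1) <= 0 by rewrite mulr_ge0_le0// subr_le0.
have : a2 * (G2 - X2) <= 0 by rewrite mulr_ge0_le0// subr_le0.
by lra.
Qed.

(* If [v] is not wide, then the single point [x] of the face [v] has wide normals
   on both sides of [v]: otherwise, turning away from [w], the normals leave
   the normal cone of [x] at a direction [v_e] that is not wide, and all
   neighbouring faces beyond [v_e] are one and the same point, which must be
   [x] in the limit. *)
Lemma all_wide v : wide v.
Proof.
apply: contrapT => nv.
have v0 : v != 0.
  apply/eqP => v0; apply: nv; rewrite v0; have [x Cx] := C0.
  by exists x, x; split=> // b _; rewrite /dot !mxE !mul0r.
have cC := spans_compact sC.
have facex u : exists x, face C u x.
  by have [x Cx hx] := compact_argmax u C0 cC; exists x.
have [x fx] := facex v; have [w [w0 ww fwx]] := wide_face v0 fx.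
have Dvw : det v w != 0.
  apply/eqP => /(det_eq0 v0)[a aE]; apply: nv.
  have a0 : a != 0 by apply: contra_neq w0 => a0; rewrite aE a0 scale0r.
  have -> : v = a^-1 *: w by rewrite aE scalerA mulVf// scale1r.
  exact: wideZ.
pose V_ t : V := v + t *: - w.
have V_w t s : V_ t = V_ s + (s - t) *: w.
  by rewrite /V_; apply: plane_eq; rewrite !mxE; ring.
have DV t : det (V_ t) w = det v w by rewrite /V_ !detE; ring.
have V0 t : V_ t != 0 by apply: (@det_neq0l _ _ w); rewrite DV.
have nfw : ~ face C (- w) x.
  by move=> fnw; move: w0; rewrite (face_antipodal hN d0 sC dC fwx fnw) eqxx.
have [e [e0 fe nxt]] := face_last fx nfw.
(* If [V_ t] were wide, [v] would lie between the wide normals [V_ t] and [w] of [x], or equal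
   [V_ t] when [t = 0]. *)
have nwE t : 0 <= t <= e -> ~ wide (V_ t).
  move=> /andP[t0 te] wt; apply: nv.
  have [tE|tN0] := eqVneq t 0.
    by move: wt; rewrite tE /V_ scale0r addr0.
  have tp : 0 < t by rewrite lt_def tN0.
  have ep : 0 < e by exact: lt_le_trans te.
  have -> : v = 1 *: V_ t + t *: w.
    by rewrite /V_ scale1r scalerN subrK.
  apply: (@wide_between _ _ x) => //; first by rewrite DV.
  have -> : V_ t = (t / e) *: V_ e + (1 - t / e) *: v.
    have : t / e * e = t by rewrite divfK ?gt_eqF.
    move: (t / e) => k <-; rewrite /V_; apply: plane_eq; rewrite !mxE; ring.
  apply: faceD => //; first exact: divr_ge0.
  by rewrite subr_ge0 ler_pdivrMr// mul1r.
have [f f0 hf] := @not_wide_open _ (- w) (nwE e (introT andP (conj e0 (lexx e)))).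
have nwt t : e <= t < e + f -> ~ wide (V_ t).
  move=> /andP[et tf].
  have -> : V_ t = V_ e + (t - e) *: - w.
    by rewrite /V_; apply: plane_eq; rewrite !mxE; ring.
  by apply: hf; apply/andP; split; lra.
have step t y : e < t < e + f -> face C (V_ t) y ->
    forall t', t < t' < e + f -> face C (V_ t') y.
  move=> /andP[et tf] fy t' /andP[tt' tf'].
  have [u [u0 wu fu]] := wide_face (V0 t) fy.
  have [a [b uE]] : exists a b, u = a *: V_ t + b *: w.
    exists (det u w / det v w), (det (V_ t) u / det v w).
    apply: (@scalerI _ _ (det v w)) => //.
    by rewrite -{1}(DV t) cramer [RHS]scalerDr !scalerA !(mulrC (det v w)) !divfK.
  have nwt' s : e <= s < e + f -> forall k, u = k *: V_ s -> False.
    move=> hs k uk; apply: (nwt _ hs).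
    have k0 : k != 0 by apply: contra_neq u0 => k0; rewrite uk k0 scale0r.
    have -> : V_ s = k^-1 *: u by rewrite uk scalerA mulVf// scale1r.
    exact: wideZ.
  have b0 : b != 0.
    apply/eqP => b0; apply: (nwt' t _ a); first by apply/andP; split; lra.
    by rewrite uE b0 scale0r addr0.
  have uV s : a * (s - t) = - b -> u = a *: V_ s.
    by move=> h; rewrite uE (V_w t s) [a *: (_ + _)]scalerDr scalerA h scaleNr subrK.
  (* The wide normal [u] of [y] avoids the interval of non-wide directions. If [b < 0] it lies
     beyond [V_ t'], which is then a normal of [y]; if [b > 0], then [V_ e] is a normal of [y], so
     [y = x], against the choice of [e]. *)
  have [bn|bp] := ltP b 0.
    have hb : a * (t' - t) <= - b.
      rewrite leNgt; apply/negP => h.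
      have ap : 0 < a by rewrite -(pmulr_lgt0 a (_ : 0 < t' - t)); lra.
      have := h; rewrite mulrC -ltr_pdivrMr// => h'.
      have h'' : 0 < - b / a by rewrite divr_gt0// oppr_gt0.
      apply: (nwt' (t + - b / a) _ a); first by apply/andP; split; lra.
      by apply: uV; rewrite addrC addKr mulrC divfK ?gt_eqF.
    have -> : V_ t' = (1 - a * (t' - t) / - b) *: V_ t + ((t' - t) / - b) *: u.
      by rewrite uE /V_; apply: plane_eq; rewrite !mxE; field.
    apply: faceD => //.
      by rewrite subr_ge0 ler_pdivrMr ?oppr_gt0// mul1r.
    by rewrite divr_ge0// ?oppr_ge0; lra.
  exfalso; have bp' : 0 < b by rewrite lt_def b0.
  have hb : a * (t - e) <= b.
    rewrite leNgt; apply/negP => h.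
    have ap : 0 < a by rewrite -(pmulr_lgt0 a (_ : 0 < t - e)); lra.
    have := h; rewrite mulrC -ltr_pdivrMr// => h'.
    have h'' : 0 < b / a by rewrite divr_gt0.
    apply: (nwt' (t - b / a) _ a); first by apply/andP; split; lra.
    by apply: uV; rewrite addrC addKr mulrN mulrC divfK ?gt_eqF.
  suff fey : face C (V_ e) y.
    apply: (nxt t et); rewrite (not_wide_face_eq (V0 e) _ fe fey)//.
    by apply: nwE; rewrite e0 lexx.
  have -> : V_ e = (1 - a * (t - e) / b) *: V_ t + ((t - e) / b) *: u.
    by rewrite uE /V_; apply: plane_eq; rewrite !mxE; field.
  apply: faceD => //.
    by rewrite subr_ge0 ler_pdivrMr// mul1r.
  by rewrite divr_ge0//; lra.
pose t1 := e + f / 2.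
have t1e : e < t1 < e + f by rewrite /t1; apply/andP; split; lra.
have [y fy] := facex (V_ t1).
have fy' t : e < t < t1 -> face C (V_ t) y.
  move=> /andP[et tt1]; have [z fz] := facex (V_ t).
  have fz1 : face C (V_ t1) z.
    by apply: (step t) => //; move: t1e => /andP[_ ?]; apply/andP; split; lra.
  rewrite (not_wide_face_eq (V0 t1) _ fy fz1)//.
  by apply: nwt; move: t1e => /andP[? ?]; apply/andP; split; lra.
have fey : face C (V_ e) y.
  apply: (@face_limit _ _ _ (- w) _ (f / 2)); first by lra.
  move=> t /andP[t0 tf].
  have -> : V_ e + t *: - w = V_ (e + t).
    by rewrite /V_; apply: plane_eq; rewrite !mxE; ring.
  by apply: fy'; rewrite /t1; apply/andP; split; lra.
apply: (nxt t1); first by case/andP: t1e.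
rewrite (not_wide_face_eq (V0 e) _ fe fey)//.
by apply: nwE; rewrite e0 lexx.
Qed.

Lemma opposite_faces u x y : face C u x -> face C (- u) y ->
  forall b, N b <= d -> dot u b <= dot u (x - y).
Proof.
move=> [_ hx] [_ hy] b Nb; have [p [q [Cp Cq h]]] := all_wide u.
by have := h _ Nb; have := hx _ Cp; have := hy _ Cq; rewrite !dotE; lra.
Qed.

(** If [x - y] were shorter than [d], lengthening it in the direction [u] inside the ball would
    exceed the width. *)
Lemma opposite_faces_dist u x y : u != 0 -> face C u x -> face C (- u) y ->
  N (x - y) = d.
Proof.
move=> u0 fx fy; apply/le_anti; rewrite (spans_diam sC (proj1 fx) (proj1 fy))/=.
rewrite leNgt; apply/negP => lt; have Nu := norm_gt0 hN u0.
have t0 : 0 < (d - N (x - y)) / N u by rewrite divr_gt0// subr_gt0.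
have := @opposite_faces _ _ _ fx fy (x - y + (d - N (x - y)) / N u *: u).
rewrite dotDr dotZr; have := mulr_gt0 t0 (dot_gt0 u0) => h1 h2.
have : dot u (x - y) + (d - N (x - y)) / N u * dot u u <= dot u (x - y).
  apply: h2; apply: le_trans (normD hN _ _) _.
  by rewrite (normZ_ge0 hN _ (ltW t0)) divfK ?gt_eqF//; lra.
lra.
Qed.

End ConstantWidth.

(** * Bisecting a set *)

Section Bisection.
Context {R : realType} {N : 'rV[R]_2 -> R} (hN : is_norm N).
Local Notation V := 'rV[R]_2.
Implicit Types (u v w x y z c : V) (S : set V).

Lemma continuous_det u : continuous (det u).
Proof.
pose u' : V := \row_i if i == 0 then - u 0 1 else u 0 0.
rewrite (_ : det u = dot u'); first exact: continuous_dot.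
by apply/funext => x; rewrite /det /dot /u' !mxE /=; ring.
Qed.

(** The two closed sides of the line contain no diametral pair of [closure S], and by compactness
    each cuts out a part of smaller diameter. *)
Lemma bisect_by_line S e (t : R) : norm_bounded N S -> 0 < diam N S ->
  (forall p q, closure S p -> closure S q -> N (p - q) = diam N S ->
    (det e p - t) * (det e q - t) < 0) ->
  exists F1 F2, [/\ F1 `<=` S, F2 `<=` S, S `<=` F1 `|` F2,
    diam N F1 < diam N S & diam N F2 < diam N S].
Proof.
move=> bS d0 sep; have cT := compact_closure_bounded hN bS.
have half G : closed G -> (forall p q, G p -> G q ->
    0 <= (det e p - t) * (det e q - t)) -> diam N (S `&` G) < diam N S.
  move=> clG hG; have cTG := compact_closedI cT clG.
  apply: (@le_lt_trans _ _ (diam N (closure S `&` G))).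
    apply: (diamS hN); last exact: (norm_bounded_compact hN).
    by apply: setSI; exact: subset_closure.
  apply: (diam_lt hN) => // x y [Sx Gx] [Sy Gy].
  have := le_diam hN (norm_bounded_closure hN bS) Sx Sy.
  rewrite (diam_closure hN bS) le_eqVlt => /orP[/eqP xy|//].
  by have := sep _ _ Sx Sy xy; rewrite ltNge hG.
exists (S `&` [set x | t <= det e x]), (S `&` [set x | det e x <= t]).
split.
- by move=> x [].
- by move=> x [].
- by move=> x Sx; have [h|h] := leP t (det e x); [left|right; split=> //=; exact: ltW].
- apply: half => [|p q /= hp hq]; last by rewrite mulr_ge0// subr_ge0.
  apply: (@preimage_closed _ _ (det e) [set r | t <= r]).
    by move=> x _; exact: continuous_det.
  exact: closed_ge.
- apply: half => [|p q /= hp hq]; last by rewrite mulr_le0// subr_le0.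
  apply: (@preimage_closed _ _ (det e) [set r | r <= t]).
    by move=> x _; exact: continuous_det.
  exact: closed_le.
Qed.

Lemma lagrange u v x y :
  det u v * det x y = dot u x * dot v y - dot v x * dot u y.
Proof. by rewrite /det /dot; ring. Qed.

(** * Position of diametral pairs relative to a chord between opposite faces *)

Section Chord.
Context {C : set V} {d : R} {u a b : V}.
Context (d0 : 0 < d) (dC : forall x y, C x -> C y -> N (x - y) <= d)
  (fa : face C u a) (fb : face C (- u) b).

Let h x := det (a - b) (x - b).

(** The functional [v] norming [p - q] is maximal on [C] at [p] and minimal at [q], which places
    them on opposite sides of the chord. If [p] is on its line, [v] is also maximal at [a] and [b],
    and the line supports [C]. *)
Lemma diametral_pair_chord p q : C p -> C q -> N (p - q) = d ->
  dot u b < dot u p < dot u a -> dot u b < dot u q < dot u a ->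
  [/\ h p * h q <= 0, ~ (h p = 0 /\ h q = 0) &
    h p = 0 -> (forall c, C c -> 0 <= h c) \/ (forall c, C c -> h c <= 0)].
Proof.
move=> Cp Cq pq /andP[bp pa] /andP[bq qa].
have d0' := d0; have Ca := proj1 fa; have Cb := proj1 fb.
have [v [hv hvx]] := norming_functional hN (p - q); rewrite pq in hvx.
have maxp c : C c -> dot v c <= dot v p.
  move=> Cc; have := hv (c - q); have := dC Cc Cq.
  by move: hvx; rewrite !dotE; lra.
have minq c : C c -> dot v q <= dot v c.
  move=> Cc; have := hv (p - c); have := dC Cp Cc.
  by move: hvx; rewrite !dotE; lra.
have hE x : det u v * h x = dot u (a - b) * dot v (x - b)
    - dot v (a - b) * dot u (x - b) by exact: lagrange.
have e0 : 0 < dot u (a - b) by rewrite !dotE; lra.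
have pqd : dot v q < dot v p by move: hvx; rewrite !dotE; lra.
have ap := maxp _ Ca; have bp' := maxp _ Cb; have aq := minq _ Ca; have bq' := minq _ Cb.
have D0 : det u v != 0.
  apply/eqP => D0; have u0 : u != 0.
    by apply/eqP => u0; move: e0; rewrite u0 /dot !mxE !mul0r addr0 ltxx.
  have [k vE] := det_eq0 u0 D0; move: pqd ap bp'; rewrite vE !dotZl.
  have [k0|k0|->] := ltrgtP k 0; last by rewrite !mul0r ltxx.
    by move=> _ _; rewrite ler_nM2l//; lra.
  by move=> _; rewrite ler_pM2l//; lra.
(* [det u v * h] vanishes on the chord and [v] is affine along it, so at [x] it is
   a convex combination of the deficits of [v] at the endpoints. *)
have hE' x : det u v * h x = (dot u a - dot u x) * (dot v x - dot v b)
    + (dot u x - dot u b) * (dot v x - dot v a).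
  by rewrite hE !dotE; ring.
have sp : 0 <= det u v * h p.
  by rewrite hE' addr_ge0// mulr_ge0//; lra.
have sq : det u v * h q <= 0.
  by rewrite hE' -oppr_ge0 opprD -!mulrN addr_ge0// mulr_ge0//; lra.
(* [k] is 1 for [p], where [v] is maximal, and -1 for [q], where it is minimal. *)
have zero x (k : R) : det u v * h x = 0 -> dot u b < dot u x < dot u a ->
    0 <= k * (dot v x - dot v a) -> 0 <= k * (dot v x - dot v b) -> k != 0 ->
    dot v x = dot v a /\ dot v x = dot v b.
  rewrite hE' => z /andP[h1 h2] h3 h4 k0.
  have g1 : 0 < dot u a - dot u x by lra.
  have g2 : 0 < dot u x - dot u b by lra.
  have k1 := mulr_ge0 (ltW g1) h4; have k2 := mulr_ge0 (ltW g2) h3.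
  have k3 : k * ((dot u a - dot u x) * (dot v x - dot v b)
    + (dot u x - dot u b) * (dot v x - dot v a)) = 0 by rewrite z mulr0.
  have k4 : (dot u x - dot u b) * (k * (dot v x - dot v a)) = 0 by lra.
  have k5 : (dot u a - dot u x) * (k * (dot v x - dot v b)) = 0 by lra.
  move/eqP: k4; rewrite !mulf_eq0 (negPf k0) (gt_eqF g2) subr_eq0 /= => /eqP k4.
  by move/eqP: k5; rewrite !mulf_eq0 (negPf k0) (gt_eqF g1) subr_eq0 /= => /eqP.
have zp : h p = 0 -> dot v p = dot v a /\ dot v p = dot v b.
  move=> z; apply: (zero _ 1); rewrite ?z ?mulr0 ?bp ?pa ?oner_eq0 ?mul1r// subr_ge0 //.
have zq : h q = 0 -> dot v q = dot v a /\ dot v q = dot v b.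
  move=> z; apply: (zero _ (-1)); rewrite ?z ?mulr0 ?bq ?qa ?oppr_eq0 ?oner_eq0 ?mulN1r// oppr_ge0 subr_le0 //.
split.
- have D2 : 0 < det u v * det u v by rewrite -expr2 lt_def sqr_ge0 andbT sqrf_eq0.
  by rewrite -(pmulr_rle0 _ D2) mulrACA; apply: mulr_ge0_le0.
- by move=> [/zp[e1 _] /zq[e2 _]]; lra.
- move=> /zp[e1 e2].
  have sc c : C c -> det u v * h c <= 0.
    move=> Cc; have := maxp _ Cc => hc; rewrite hE !dotE -e1 -e2 subrr mul0r subr0.
    by rewrite mulr_ge0_le0//; lra.
  have [Dn|Dp] := ltP (det u v) 0.
    by left=> c /sc; rewrite nmulr_rle0.
  right=> c /sc; rewrite pmulr_rle0// lt_def D0//.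
Qed.

End Chord.

(** The line through [a] and [b] bisects [S] unless some diametral pair meets it. In that case it
    supports [C], every diametral pair has one point on it, and the other points keep at least a
    distance proportional to [m > 0]; the line is displaced by half of that. *)
Lemma bisect_between_faces S C u a b : norm_bounded N S -> 0 < diam N S ->
  closure S `<=` C -> (forall x y, C x -> C y -> N (x - y) <= diam N S) ->
  face C u a -> face C (- u) b ->
  (forall s, closure S s -> ~ face C u s /\ ~ face C (- u) s) ->
  exists F1 F2, [/\ F1 `<=` S, F2 `<=` S, S `<=` F1 `|` F2,
    diam N F1 < diam N S & diam N F2 < diam N S].
Proof.
move=> bS d0 SC dC fa fb miss.
pose h x := det (a - b) (x - b).
have strict s : closure S s -> dot u b < dot u s < dot u a.
  move=> Ss; have [m1 m2] := miss _ Ss; have Cs := SC _ Ss.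
  apply/andP; split; rewrite ltNge; apply/negP => le.
    apply: m2; split=> // c Cc; have := fb.2 _ Cc; rewrite !dotE; lra.
  by apply: m1; split=> // c Cc; have := fa.2 _ Cc; lra.
have key p q : closure S p -> closure S q -> N (p - q) = diam N S -> 
    [/\ h p * h q <= 0, ~ (h p = 0 /\ h q = 0) &
    h p = 0 -> (forall c, C c -> 0 <= h c) \/ (forall c, C c -> h c <= 0)].
  move=> Sp Sq pq.
  exact: (diametral_pair_chord d0 dC fa fb (SC _ Sp) (SC _ Sq) pq (strict _ Sp) (strict _ Sq)).
have [[p [q [Sp Sq pq hp]]]|nz] := pselect (exists p q, [/\ closure S p, closure S q,
    N (p - q) = diam N S & h p = 0]); last first.
  apply: (@bisect_by_line _ (a - b) (det (a - b) b)) => // p q Sp Sq pq.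
  have hE x : det (a - b) x - det (a - b) b = h x by rewrite /h detDr detNr.
  rewrite !hE lt_def; have [-> _ _] := key _ _ Sp Sq pq; rewrite andbT eq_sym mulf_neq0//.
    by apply/eqP => z; apply: nz; exists p, q.
  by apply/eqP => z; apply: nz; exists q, p; split=> //; rewrite (normB hN).
have [_ _ /(_ hp) sgn] := key _ _ Sp Sq pq.
have [s s0 hs] : exists2 s : R, s != 0 & forall c, C c -> 0 <= s * h c.
  case: sgn => [h0|h0].
    by exists 1; [exact: oner_neq0|move=> c /h0; rewrite mul1r].
  by exists (-1); [rewrite oppr_eq0 oner_neq0|move=> c /h0; rewrite mulN1r oppr_ge0].
pose D : set (V * V) := (closure S `*` closure S) `&`
  [set x | N (x.1 - x.2) = diam N S].
have cD : compact D.
  apply: compact_closedI.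
    by apply: compact_setX; exact: (compact_closure_bounded hN).
  apply: (@preimage_closed _ _ (fun x : V * V => N (x.1 - x.2)) [set r | r = diam N S]).
    by move=> x _; exact: (continuous_norm_sub hN).
  exact: closed_eq.
have ch : continuous (fun x : V * V => - (s * (h x.1 + h x.2))).
  have c1 : continuous h.
    move=> x; apply: (@continuous_comp _ _ _ (fun x => x - b) (det (a - b))).
      by apply: continuousB; [exact: cvg_id|exact: cst_continuous].
    exact: continuous_det.
  move=> x; apply: cvgN; apply: cvgM; first exact: cvg_cst.
  by apply: cvgD; [apply: (@continuous_comp _ _ _ fst h); [exact: cvg_fst|exact: c1]
    |apply: (@continuous_comp _ _ _ snd h); [exact: cvg_snd|exact: c1]].
have [|[p0 q0] [[/= Sp0 Sq0] /= pq0] hmin] := compact_max _ cD ch.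
  by exists (p, q).
set m := s * (h p0 + h q0).
have m0 : 0 < m.
  have [k1 k2 _] := key _ _ Sp0 Sq0 pq0.
  have k3 := hs _ (SC _ Sp0); have k4 := hs _ (SC _ Sq0).
  rewrite /m lt_def mulrDr addr_ge0// andbT paddr_eq0// !mulf_eq0 (negPf s0) /=.
  by apply/negP => /andP[/eqP ? /eqP ?]; apply: k2.
apply: (@bisect_by_line _ (a - b) (det (a - b) b + m / 2 / s)) => // x y Sx Sy xy.
have hE z : det (a - b) z - (det (a - b) b + m / 2 / s) = (s * h z - m / 2) / s.
  by rewrite /h detDr detNr; field.
rewrite !hE mulrACA; have ss : 0 < s^-1 * s^-1.
  by rewrite -expr2 lt_def sqr_ge0 andbT sqrf_eq0 invr_eq0.
rewrite pmulr_llt0//.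
have [k1 _ _] := key _ _ Sx Sy xy.
have k3 := hs _ (SC _ Sx); have k4 := hs _ (SC _ Sy).
have k5 : m <= s * h x + s * h y.
  by have := hmin (x, y) (conj (conj Sx Sy) xy); rewrite /= lerN2 => /le_trans; apply; rewrite mulrDr.
have : (s * h x) * (s * h y) = 0.
  apply/le_anti; rewrite mulr_ge0// andbT mulrACA.
  by apply: mulr_ge0_le0 => //; rewrite -expr2 sqr_ge0.
move=> /eqP; rewrite mulf_eq0 => /orP[|] /eqP z; rewrite z in k5 *.
  by rewrite nmulr_rlt0; lra.
by rewrite nmulr_llt0; lra.
Qed.

Lemma bisect_nonunique S : norm_bounded N S -> 0 < diam N S ->
  ~ unique_completion N S ->
  exists F1 F2, [/\ F1 `<=` S, F2 `<=` S, S `<=` F1 `|` F2,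
    diam N F1 < diam N S & diam N F2 < diam N S].
Proof.
move=> bS d0 nu.
pose I : set V := [set z | forall s, S s -> N (z - s) <= diam N S].
(* Otherwise [I] has the diameter of [S]; as it contains every complete candidate, it would be the
   unique completion. *)
have [z [c [Iz Ic zc]]] : exists z c, [/\ I z, I c & diam N S < N (z - c)].
  apply: contrapT => H; apply: nu.
  have dI x y : I x -> I y -> N (x - y) <= diam N S.
    by move=> Ix Iy; rewrite leNgt; apply/negP => lt; apply: H; exists x, y.
  have bI := diam_le_bounded hN dI.
  have SI : S `<=` I by move=> x Sx s Ss; exact: le_diam.
  have eI : diam N I = diam N S.
    by apply/le_anti; rewrite (diam_le (ltW d0) dI)/= diamS.
  have uniq D : complete_body N D -> S `<=` D -> diam N D = diam N S -> D = I.
    move=> [bD hD] SD eD.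
    have DI : D `<=` I by move=> x Dx s /SD Ds; rewrite -eD; exact: le_diam.
    apply/seteqP; split=> //; apply: contrapT => nID.
    by apply: (hD I bI); rewrite ?eD.
  have [D [cD SD eD]] := exists_complete hN bS.
  exists D; split=> // D' [cD' SD' eD'].
  by rewrite (uniq D)// (uniq D').
have zc0 : 0 < N (z - c) by exact: lt_trans zc.
(* The factor that shrinks the segment from [c] to [z] to length [diam N S] about its midpoint. *)
pose l := diam N S / N (z - c).
have l0 : 0 < l by exact: divr_gt0.
have l1 : l < 1 by rewrite /l ltr_pdivrMr// mul1r.
pose z' := ((1 + l) / 2) *: z + ((1 - l) / 2) *: c.
pose c' := ((1 - l) / 2) *: z + ((1 + l) / 2) *: c.
have comb (a b : R) : 0 <= a -> 0 <= b -> a + b = 1 -> I (a *: z + b *: c).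
  move=> a0 b0 ab s Ss.
  have -> : a *: z + b *: c - s = a *: (z - s) + b *: (c - s).
    by rewrite -{1}(scale1r s) -ab scalerDl !scalerBr opprD addrACA.
  apply: le_trans (normD hN _ _) _; rewrite !(normZ_ge0 hN)//.
  have := ler_wpM2l a0 (Iz _ Ss); have := ler_wpM2l b0 (Ic _ Ss).
  have : a * diam N S + b * diam N S = diam N S by rewrite -mulrDl ab mul1r.
  lra.
have Iz' : I z' by apply: comb; lra.
have Ic' : I c' by apply: comb; lra.
have zc'E : z' - c' = l *: (z - c).
  by rewrite /z' /c'; apply: plane_eq; rewrite !mxE; lra.
have zc' : N (z' - c') = diam N S.
  by rewrite zc'E (normZ_ge0 hN _ (ltW l0)) /l divfK ?gt_eqF.
pose A := S `|` [set z'; c'].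
have dA x y : A x -> A y -> N (x - y) <= diam N S.
  move=> [Sx|[->|->]] [Sy|[->|->]]; rewrite ?subrr ?(norm0 hN) ?(ltW d0)//.
  - exact: le_diam.
  - by rewrite (normB hN); exact: Iz'.
  - by rewrite (normB hN); exact: Ic'.
  - exact: Iz'.
  - by rewrite zc'.
  - exact: Ic'.
  - by rewrite (normB hN) zc'.
have bA := diam_le_bounded hN dA.
have SA : S `<=` A by exact: subsetUl.
have eA : diam N A = diam N S.
  by apply/le_anti; rewrite (diam_le (ltW d0) dA)/= diamS.
have [C [cC AC eC]] := exists_complete hN bA.
have sC := complete_spans hN cC; rewrite eC eA in sC.
have Cz' : C z' by apply: AC; right; left.
have Cc' : C c' by apply: AC; right; right.
have SC : S `<=` C by move=> x /SA /AC.
have clSC : closure S `<=` C.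
  by move=> x Sx; apply: (complete_closed hN cC); exact: closureS SC _ Sx.
have clI x s : I x -> closure S s -> N (x - s) <= diam N S.
  move=> Ix Ss; apply/ler_addgt0Pr => e /(closure_norm hN Ss)[a [Sa sa]].
  have := norm_triangle hN a x s; rewrite (normB hN a s).
  by have := Ix _ Sa; lra.
have [u [hu huzc]] := norming_functional hN (z' - c').
rewrite zc' in huzc.
have uzc : dot u (z - c) * l = diam N S by rewrite mulrC -dotZr -zc'E.
have uzc0 : 0 < dot u (z - c) by rewrite -(pmulr_lgt0 _ l0) uzc.
have far : 0 < (1 - l) / 2 * dot u (z - c) by apply: mulr_gt0 => //; lra.
apply: (bisect_between_faces bS d0 clSC (spans_diam sC) (u := u) (a := z') (b := c')).
- split=> // x Cx; have := hu (x - c'); have := spans_diam sC Cx Cc'.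
  by move: huzc; rewrite !dotE; lra.
- split=> // x Cx; have := hu (z' - x); have := spans_diam sC Cz' Cx.
  by move: huzc; rewrite !dotE; lra.
(* On the face of [z'], [u] exceeds its value at [c'] by the diameter, and its value at [c] by
   strictly more, so [s] would be too far from [c]; likewise for the other face and [z]. *)
- move=> s Ss; split=> -[Cs hs].
    have := hs _ Cz'; have := hu (s - c); have := clI _ _ Ic Ss; rewrite (normB hN c).
    move: huzc uzc far; rewrite /z' /c' !dotE; lra.
  have := hs _ Cc'; have := hu (z - s); have := clI _ _ Iz Ss.
  by move: huzc uzc far; rewrite /z' /c' !dotE; lra.
Qed.

End Bisection.

(** * Supporting lines and k-fold covers *)

Section SupportingLines.
Context {R : realType} {N : 'rV[R]_2 -> R} (hN : is_norm N).
Local Notation V := 'rV[R]_2.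
Implicit Types (u v w x y z : V) (S T C : set V) (a : 'cV[R]_2).

Lemma dot_tr x a : (x *m a) 0 0 = dot a^T x.
Proof.
rewrite mxE big_ord_recl big_ord1 /dot !mxE mulrC (mulrC (a 1 0)).
by congr (_ + _ * _); [congr (x _ _)|congr (a _ _)]; exact: val_inj.
Qed.

Lemma line_tr_scale a1 a2 (c1 c2 : R) : a1 != 0 -> line a1 c1 = line a2 c2 ->
  exists k, a2^T = k *: a1^T.
Proof.
move=> a10 e12; have u0 : a1^T != 0 by rewrite trmx_eq0.
pose x0 := (c1 / dot a1^T a1^T) *: a1^T.
have l0 : line a1 c1 x0.
  by rewrite /line /= dot_tr dotZr divfK// gt_eqF// dot_gt0.
apply: dot_perp u0 _ => w hw.
have l1 : line a1 c1 (x0 + w) by move: l0; rewrite /line /= !dot_tr dotDr hw addr0.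
by move: l0 l1; rewrite e12 /line /= !dot_tr dotDr; lra.
Qed.

(** The normals of two parallel supporting lines are proportional; distinct lines have a negative
    factor, so they carry opposite faces. *)
Lemma missed_faces T C : completion N T C -> ~ supporting_line_property N T ->
  exists u x y, [/\ face C u x, face C (- u) y &
    forall s, T s -> ~ face C u s /\ ~ face C (- u) s].
Proof.
move=> comp nslp; apply: contrapT => H; apply: nslp; exists C; split=> //.
move=> L1 L2 [a1 [c1 [a10 -> [x1 [Cx1 Lx1]] sup1]]] [a2 [c2 [a20 -> [x2 [Cx2 Lx2]] sup2]]].
move=> [a0 [e1 [e2 [a00 E1 E2]]]] neq.
apply: contrapT => /not_orP[n1 n2]; apply: H.
move: Lx1 Lx2; rewrite /line /= !dot_tr => Lx1 Lx2.
have [k1 k1E] := line_tr_scale a00 (esym E1).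
have [k2 k2E] := line_tr_scale a00 (esym E2).
have k10 : k1 != 0.
  by apply: contraNneq a10 => k; rewrite -trmx_eq0 k1E k scale0r.
have k20 : k2 != 0.
  by apply: contraNneq a20 => k; rewrite -trmx_eq0 k2E k scale0r.
have a2E : a2^T = (k2 / k1) *: a1^T by rewrite k1E k2E scalerA divfK.
have k0 : k2 / k1 != 0 by rewrite mulf_neq0// invr_eq0.
move: (k2 / k1) k0 a2E => k k0 a2E {k1 k2 k1E k2E k10 k20}.
have s1 c : C c -> dot a1^T c <= c1 by move=> /sup1; rewrite dot_tr.
have s2 c : C c -> k * dot a1^T c <= c2 by move=> /sup2; rewrite dot_tr a2E dotZl.
rewrite a2E dotZl in Lx2.
(* With [k > 0] both lines would support [C] on the same side and coincide. *)
have kn : k < 0.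
  rewrite lt_neqAle k0 leNgt; apply/negP => kp; apply: neq.
  have -> : c2 = k * c1.
    apply/le_anti; rewrite -Lx1 s2// andbT -Lx2 ler_pM2l// Lx1; exact: s1.
  apply/seteqP; split=> x; rewrite /line /= !dot_tr a2E dotZl.
    by move=> ->.
  exact: mulfI.
exists a1^T, x1, x2; split.
- by split=> // c Cc; rewrite Lx1; exact: s1.
- split=> // c Cc; rewrite !dotNl lerN2 -(ler_nM2l kn) Lx2; exact: s2.
- move=> s Ts; split=> -[Cs hs]; [apply: n1|apply: n2]; exists s; split=> //.
    by rewrite /line /= dot_tr; apply/le_anti; rewrite s1//= -Lx1 hs.
  rewrite /line /= dot_tr a2E dotZl; apply/le_anti; rewrite s2//= -Lx2 ler_nM2l//.
  by have := hs _ Cx2; rewrite !dotNl lerN2.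
Qed.

(** The condition [dot u x != dot u y] makes the two supporting lines distinct, as the property
    requires. *)
Lemma face_hit S C u x y : supporting_line_property N S -> completion N S C ->
  u != 0 -> face C u x -> face C (- u) y -> dot u x != dot u y ->
  exists2 s, S s & face C u s \/ face C (- u) s.
Proof.
move=> [C' [[cC' uC'] slp]] comp u0 fx fy xy.
rewrite (uC' _ comp.1) in slp; have [_ SC _] := comp.1.
have [] := slp (line u^T (dot u x)) (line u^T (dot u y)).
- exists u^T, (dot u x); split=> //; first by rewrite trmx_eq0.
    by exists x; split; [case: fx|rewrite /line /= dot_tr trmxK].
  by move=> c /fx.2; rewrite dot_tr trmxK.
- exists (- u^T), (- dot u y); split=> //; first by rewrite oppr_eq0 trmx_eq0.
  + apply/seteqP; split=> z; rewrite /line /= !dot_tr linearN /= !trmxK dotNl.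
      by move=> ->.
    exact: oppr_inj.
  + by exists y; split; [case: fy|rewrite /line /= dot_tr trmxK].
  + by move=> c /fy.2; rewrite dot_tr linearN /= trmxK !dotNl.
- by exists u^T, (dot u x), (dot u y); split=> //; rewrite trmx_eq0.
- move=> e; move/eqP: xy; apply.
  have : line u^T (dot u x) x by rewrite /line /= dot_tr trmxK.
  by rewrite e /line /= dot_tr trmxK.
- move=> [s [Ss]]; rewrite /line /= dot_tr trmxK => sE; exists s => //; left.
  by split=> [|c /fx.2]; [exact: SC|rewrite sE].
- move=> [s [Ss]]; rewrite /line /= dot_tr trmxK => sE; exists s => //; right.
  by split=> [|c /fy.2]; [exact: SC|rewrite !dotNl sE].
Qed.

Lemma completion_closure S C : norm_bounded N S -> completion N S C ->
  completion N (closure S) C.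
Proof.
move=> bS [[cC SC eC] uC]; have eS := diam_closure hN bS.
split.
  split; rewrite ?eS// => x Sx; apply: (complete_closed hN cC).
  exact: closureS SC _ Sx.
move=> D [cD SD eD]; apply: uC; split=> //; last by rewrite eD.
by move=> x /subset_closure/SD.
Qed.

End SupportingLines.

(** * The bound 2k and covers built from two halves *)

Section Counting.
Context {R : realType} {N : 'rV[R]_2 -> R} (hN : is_norm N).
Local Notation V := 'rV[R]_2.
Implicit Types (x y : V) (S : set V).

Lemma leq_card_inj k m (P : pred 'I_m) (f : 'I_k -> 'I_m) :
  injective f -> (forall i, P (f i)) -> (k <= #|P|)%N.
Proof.
move=> finj fP; rewrite -{1}(card_ord k) -(card_codom finj).
by apply: subset_leq_card; apply/fintype.subsetP => _ /codomP[i ->]; exact: fP.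
Qed.

(* Two points at a distance exceeding the diameters of all members of the family
   have disjoint sets of indices. *)
Lemma kfold_cover_ge S k m (F : 'I_m -> set V) : norm_bounded N S ->
  0 < diam N S -> kfold_cover N k S F -> (2 * k <= m)%N.
Proof.
move=> bS d0 [hF cF].
have [r r0 [rd hr]] : exists2 r, 0 <= r & r < diam N S /\
    forall i, diam N (F i) <= r.
  exists (\big[Num.max/0]_i diam N (F i)); first exact: bigmax_ge_id.
  split=> [|i]; last exact: le_bigmax.
  by apply/bigmax_ltP; split=> // i _; exact: (hF i).2.
have [x [y [Sx Sy xy]]] := lt_diam r0 rd.
have := max_card [predU [pred i | x \in F i] & [pred i | y \in F i]].
rewrite card_ord; apply: leq_trans; rewrite mul2n -addnn.
apply: leq_trans (leq_add (cF _ Sx) (cF _ Sy)) _.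
rewrite -cardUI (_ : #|[predI _ & _]| = 0)%N ?addn0//.
apply: eq_card0 => i; rewrite !inE; apply/negP => /andP[/set_mem xF /set_mem yF].
have bF : norm_bounded N (F i) by apply: norm_boundedS bS; exact: (hF i).1.
by have := le_diam hN bF xF yF; have := hr i; lra.
Qed.

Lemma kfold_cover_bisect S F1 F2 k : F1 `<=` S -> F2 `<=` S ->
  S `<=` F1 `|` F2 -> diam N F1 < diam N S -> diam N F2 < diam N S ->
  exists F : 'I_(2 * k) -> set V, kfold_cover N k S F.
Proof.
move=> s1 s2 S12 d1 d2.
exists (fun i => if (i < k)%N then F1 else F2); split=> [i|x /S12[x1|x2]].
- by case: ifP.
- have lt (i : 'I_k) : (i < 2 * k)%N.
    by apply: leq_trans (ltn_ord i) _; rewrite mul2n -addnn leq_addr.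
  apply: (@leq_card_inj _ _ _ (fun i => Ordinal (lt i))) => [i j [] /val_inj//|i].
  by rewrite inE /= ltn_ord mem_set.
- have lt (i : 'I_k) : (k + i < 2 * k)%N.
    by rewrite mul2n -addnn ltn_add2l.
  apply: (@leq_card_inj _ _ _ (fun i => Ordinal (lt i))) => [i j []|i].
    by move/addnI/val_inj.
  by rewrite inE /= ltnNge leq_addr mem_set.
Qed.

Theorem borsuk_number_even S k : norm_bounded N S -> 0 < diam N S ->
  ~ unique_completion N S \/ ~ supporting_line_property N (closure S) ->
  is_borsuk_number N k S (2 * k)%N.
Proof.
move=> bS d0 H; split; last by move=> m F; exact: kfold_cover_ge.
suff [F1 [F2 [s1 s2 S12 d1 d2]]] : exists F1 F2, [/\ F1 `<=` S, F2 `<=` S,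
    S `<=` F1 `|` F2, diam N F1 < diam N S & diam N F2 < diam N S].
  exact: (@kfold_cover_bisect S F1 F2).
have [[C comp]|/(bisect_nonunique hN bS d0)//] := pselect (unique_completion N S).
case: H => [[]|nslp]; first by exists C.
have ccomp := completion_closure hN bS comp.
have [u [x [y [fx fy miss]]]] := missed_faces ccomp nslp.
have sC := completion_spans hN bS comp.
exact: (bisect_between_faces hN bS d0 (spans_sub sC) (spans_diam sC) fx fy miss).
Qed.

End Counting.

(** * Closed sets of directions *)

Section LowerBound.
Context {R : realType} {N : 'rV[R]_2 -> R} (hN : is_norm N).
Local Notation V := 'rV[R]_2.
Implicit Types (u v w x y z : V) (S T C P : set V).

(** Some point [c] of [C] exceeds the maximum of [u] over [P], and this gap absorbs small changes of
    [u]. *)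
Lemma not_normal_open C P u : compact P -> P `<=` C -> norm_bounded N C ->
  ~ (exists2 x, P x & face C u x) ->
  exists2 e, 0 < e & forall v, N v < e -> ~ (exists2 x, P x & face C (u + v) x).
Proof.
move=> cP PC bC nu; have [P0|/set0P P0] := eqVneq P set0.
  by exists 1 => // v _ [x]; rewrite P0.
have [p Pp hp] := compact_argmax u P0 cP.
have [c Cc pc] : exists2 c, C c & dot u p < dot u c.
  apply: contrapT => H; apply: nu; exists p => //; split=> [|c Cc]; first exact: PC.
  by rewrite leNgt; apply/negP => lt; apply: H; exists c.
have [M hM] := bC.
have [K K0 hK] := sup_norm_le_norm hN.
have M0 : 0 <= M by apply: le_trans (hM _ Cc); exact: norm_ge0.
(* From [ler_dot], with one factor [K] for each passage from the sup norm to [N] and [2 * M]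
   bounding [N (x - c)]; the 1 makes [L] positive. *)
pose L := 2 * K * K * (2 * M) + 1.
have L0 : 0 < L.
  by rewrite /L ltr_wpDl// !mulr_ge0// ltW.
exists ((dot u c - dot u p) / L); first by rewrite divr_gt0// subr_gt0.
move=> v; rewrite ltr_pdivlMr// => vL [x Px [Cx /(_ _ Cc)]].
have Nxc : N (x - c) <= 2 * M.
  have := normD hN x (- c); rewrite (normN hN); have := hM _ Cx; have := hM _ Cc; lra.
have b1 : `|dot v (x - c)| <= 2 * (K * N v) * (K * (2 * M)).
  apply: le_trans (ler_dot _ _) _; apply: ler_pM => //; rewrite ?mulr_ge0//.
    by rewrite ler_pM2l//; exact: hK.
  by apply: le_trans (hK _) _; rewrite ler_pM2l.
have b2 : 2 * (K * N v) * (K * (2 * M)) <= N v * L.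
  have := norm_ge0 hN v; rewrite /L mulrDr mulr1.
  have -> : 2 * (K * N v) * (K * (2 * M)) = N v * (2 * K * K * (2 * M)) by ring.
  by lra.
have := hp _ Px; have := ler_norm (dot v (x - c)).
by move: b1 b2 vL; rewrite !dotE; lra.
Qed.

(* The path [t |-> (t, 1 - |t|)] joins [- e] to [e] avoiding [0]. *)
Lemma symmetric_cover (X : set V) :
  (forall u, ~ X u -> exists2 e, 0 < e & forall v, N v < e -> ~ X (u + v)) ->
  (forall u, u != 0 -> X u \/ X (- u)) ->
  exists u, [/\ u != 0, X u & X (- u)].
Proof.
move=> Xo Xc; apply: contrapT => H.
have only u : u != 0 -> X u -> ~ X (- u) by move=> u0 Xu Xu'; apply: H; exists u.
pose g (t : R) : V := \row_i if i == 0 then t else 1 - `|t|.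
have g0 t : g t != 0.
  apply/eqP => /rowP h; have := h 0; have := h 1; rewrite !mxE /= => + t0.
  by rewrite t0 normr0 subr0 => /eqP; rewrite oner_eq0.
have gN : g (-1) = - g 1.
  by apply: plane_eq; rewrite !mxE //= normrN normr1 subrr oppr0.
have [K K0 hK] := norm_le_sup_norm hN.
have hg s t : N (g s - g t) <= K * `|s - t|.
  apply: le_trans (hK _) _; rewrite ler_pM2l//.
  rewrite [leLHS]/Num.norm/= mx_normrE; apply/bigmax_leP; split=> // -[i j] _ /=.
  rewrite !mxE; case: ifP => // _.
  rewrite opprD addrACA subrr add0r opprK addrC.
  by rewrite distrC ler_dist_dist.
have op (Y : set V) : (forall u, ~ Y u -> exists2 e, 0 < e &
    forall v, N v < e -> ~ Y (u + v)) -> closed [set t | Y (g t)].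
  move=> Yo t ct; apply: contrapT => nY; have [e e0 he] := Yo _ nY.
  have [s [/= Ys]] : [set t | Y (g t)] `&` ball t (e / K) !=set0.
    by apply: ct; apply: nbhsx_ballx; exact: divr_gt0.
  rewrite -ball_normE /= ltr_pdivlMr// mulrC => ts.
  have := he (g s - g t); rewrite subrKC; apply=> //.
  by apply: le_lt_trans (hg _ _) _; rewrite distrC.
have cX := op X Xo.
have cX' : closed [set t | X (- g t)].
  apply: (op [set u | X (- u)]) => u /= /Xo[e e0 he].
  by exists e => // v Nv; rewrite opprD; apply: he; rewrite (normN hN).
have conn := @segment_connected R (-1) 1.
wlog X1 : X Xo Xc H only op cX cX' / X (g 1).
  move=> wl; have [X1|X1] := Xc _ (g0 1); first exact: (wl X).
  apply: (wl [set u | X (- u)]) => //=.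
  - move=> u /Xo[e e0 he].
    by exists e => // v Nv; rewrite opprD; apply: he; rewrite (normN hN).
  - by move=> u /Xc[Xu|Xu]; [right; rewrite opprK|left].
  - by move=> [u [u0 Xu Xu']]; apply: H; exists u; rewrite opprK in Xu'.
  - by move=> u u0; rewrite opprK => Xu Xu'; exact: (only u).
  - by rewrite (_ : [set t | X (- - g t)] = [set t | X (g t)])//;
      apply/seteqP; split=> t /=; rewrite opprK.
have I1 : `[-1, 1]%classic (1 : R) by rewrite /= in_itv /=; apply/andP; split; lra.
have I1' : `[-1, 1]%classic (-1 : R) by rewrite /= in_itv /=; apply/andP; split; lra.
(* On the segment [X (g t)] is the complement of [X (- g t)], so it is open and closed there, and
   holds at -1 as well as at 1. *)
have e : `[-1, 1] `&` [set t | X (g t)] = `[-1, 1]%classic.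
  apply: conn; first by exists 1.
    exists (~` [set t | X (- g t)]); first exact: closed_openC.
    apply/seteqP; split=> t [It h]; split=> //=; first exact: only.
    by have [//|/h] := Xc _ (g0 t).
  by exists [set t | X (g t)].
move: I1'; rewrite -e => -[_] /=; rewrite gN; exact: only.
Qed.

End LowerBound.

(** * The lower bound 2k + 1 *)

Section OddLowerBound.
Context {R : realType} {N : 'rV[R]_2 -> R} (hN : is_norm N).
Local Notation V := 'rV[R]_2.
Implicit Types (u v w x y z : V) (S C : set V).

(** The family is finite, so near [x] only those members occur whose closure contains [x]. *)
Lemma kfold_cover_closure S k m (F : 'I_m -> set V) x : kfold_cover N k S F ->
  closure S x -> (k <= #|[pred i | x \in closure (F i)]|)%N.
Proof.
move=> [_ cF] Sx.
have : nbhs x [set y | forall i, ~ closure (F i) x -> ~ F i y].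
  apply: (@filter_forall _ _ (fun i y => ~ closure (F i) x -> ~ F i y) (nbhs x)) => i.
  have [ni|ni] := pselect (closure (F i) x); first exact: filterE.
  have : nbhs x (~` closure (F i)).
    by apply: open_nbhs_nbhs; split=> //; apply: closed_openC; exact: closed_closure.
  by apply: filterS => y ny _ /subset_closure.
move=> /Sx[s [Ss hs]]; apply: leq_trans (cF _ Ss) _; apply: subset_leq_card.
apply/fintype.subsetP => i; rewrite !inE => /set_mem Fs; apply/mem_set.
by apply: contrapT => /hs; apply.
Qed.

Lemma kfold_cover_gt S C k m (F : 'I_m -> set V) : norm_bounded N S ->
  0 < diam N S -> completion N S C -> supporting_line_property N S ->
  (0 < k)%N -> kfold_cover N k S F -> (2 * k < m)%N.
Proof.
move=> bS d0 comp slp k0 kF; rewrite ltnNge; apply/negP => mk.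
have sT := completion_spans hN bS comp.
have [[cC SC eC] _] := comp.
have sC := complete_spans hN cC; rewrite eC in sC.
set d := diam N S in d0 sT sC eC.
pose T := closure S; pose G i := closure (F i).
have bF i : norm_bounded N (F i) by apply: norm_boundedS bS; exact: (kF.1 i).1.
have GT i : G i `<=` T by apply: closureS; exact: (kF.1 i).1.
have notboth x y i : N (x - y) = d -> G i x -> G i y -> False.
  move=> xy Gx Gy; have := le_diam hN (norm_bounded_closure hN (bF i)) Gx Gy.
  by rewrite xy (diam_closure hN (bF i)) leNgt (kF.1 i).2.
(* Two disjoint label sets of size at least [k] exhaust the at most [2 * k] labels. *)
have either x y i : T x -> T y -> N (x - y) = d -> ~ G i x -> G i y.
  move=> Tx Ty xy nGx; apply: contrapT => nGy.
  have := leq_add (kfold_cover_closure kF Tx) (kfold_cover_closure kF Ty).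
  rewrite -cardUI (_ : #|[predI _ & _]| = 0)%N ?addn0; last first.
    apply: eq_card0 => j; rewrite !inE; apply/negP => /andP[/set_mem ? /set_mem ?].
    exact: (notboth x y j).
  rewrite addnn -mul2n => le.
  have : (m <= #|predC1 i|)%N.
    apply: leq_trans (leq_trans mk le) _.
    apply: subset_leq_card; apply/fintype.subsetP => j; rewrite !inE => h.
    by apply/eqP => ji; move: h; rewrite ji => /orP[] /set_mem.
  by rewrite cardC1 card_ord leqNgt prednK ?leqnn// (leq_ltn_trans _ (ltn_ord i)).
have [x0 Sx0] := diam_nonempty d0.
have [i0 _] : exists i0 : 'I_m, x0 \in F i0.
  have := leq_trans k0 (kF.2 _ Sx0).
  by move=> /card_gt0P[i hi]; exists i.
(* The first coordinates form the set [T1] of those points of [T] without the label [i0] that have a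
   partner in [T]; the description through labelled partners makes it compact. *)
pose D : set (V * V) := (T `*` G i0) `&` [set x | N (x.1 - x.2) = d].
pose T1 : set V := fst @` D.
have cG : compact (G i0) by exact: (compact_closure_bounded hN).
have cT1 : compact T1.
  apply: continuous_compact.
    by apply: continuous_subspaceT => x; exact: cvg_fst.
  apply: compact_closedI; first by apply: compact_setX => //; exact: (spans_compact sT).
  apply: (@preimage_closed _ _ (fun x : V * V => N (x.1 - x.2)) [set r | r = d]).
    by move=> x _; exact: (continuous_norm_sub hN).
  exact: closed_eq.
have T1P x : T1 x -> T x /\ ~ G i0 x.
  move=> [[a b] [[/= Ta Gb] /= ab] <-]; split=> // Ga; exact: (notboth a b i0).
have T1I x : T x -> ~ G i0 x -> forall y, T y -> N (x - y) = d -> T1 x.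
  move=> Tx nGx y Ty xy; exists (x, y) => //; split=> //; split=> //=.
  exact: (either x y).
(* Directions whose face has a point labelled [i0], or whose opposite face has an unlabelled point.
   [X] is closed, and [face_hit] puts [u] or [- u] in it. *)
pose X : set V := [set u | (exists2 x, G i0 x & face C u x) \/
  (exists2 x, T1 x & face C (- u) x)].
have opd u x y := @opposite_faces_dist _ _ hN _ _ d0 sC eC u x y.
have anti u x := @face_antipodal _ _ hN C d u x d0 sC eC.
have [u [u0 Xu Xu']] : exists u, [/\ u != 0, X u & X (- u)].
  apply: (symmetric_cover hN) => u.
    move=> nX.
    have [e1 e10 h1] : exists2 e, 0 < e & forall v, N v < e ->
        ~ exists2 x, G i0 x & face C (u + v) x.
      apply: (not_normal_open hN) => //; first by move=> x /GT /(spans_sub sT).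
        exact: cC.1.
      by move=> h; apply: nX; left.
    have [e2 e20 h2] : exists2 e, 0 < e & forall v, N v < e ->
        ~ exists2 x, T1 x & face C (- u + v) x.
      apply: (not_normal_open hN) => //; first by move=> x /T1P[/(spans_sub sT)].
        exact: cC.1.
      by move=> h; apply: nX; right.
    exists (Num.min e1 e2); first by rewrite lt_min e10.
    move=> v; rewrite lt_min => /andP[v1 v2] [/h1//|].
    by rewrite opprD; apply: h2 => //; rewrite (normN hN).
  move=> u0.
  have C0 : C !=set0 by exists x0; exact: SC.
  have [x Cx hx] := compact_argmax u C0 (spans_compact sC).
  have [y Cy hy] := compact_argmax (- u) C0 (spans_compact sC).
  have hit w s : w != 0 -> T s -> face C w s -> X w \/ X (- w).
    move=> w0 Ts fs; have [Gs|nGs] := pselect (G i0 s); first by left; left; exists s.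
    have [y' [v [[Ty _ sy _ _] _]]] := face_partner hN d0 sT w0 fs.
    by right; right; rewrite opprK; exists s => //; exact: (T1I s Ts nGs y').
  have [|s Ss [fs|fs]] := face_hit slp comp u0 (conj Cx hx) (conj Cy hy).
  - apply/eqP => xy; move: u0; rewrite (anti u x) ?eqxx//; split=> // c Cc.
    by have := hy _ Cc; rewrite !dotNl xy.
  - by apply: (hit u s) => //; exact: subset_closure.
  - have := hit (- u) s; rewrite opprK => h.
    by apply/or_comm; apply: h => //; [rewrite oppr_eq0|exact: subset_closure].
(* No face contains both kinds of points: a partner of the midpoint lies on the opposite face, at
   distance [d] from both, and cannot be labelled consistently. *)
have same w x x' : w != 0 -> G i0 x -> face C w x -> T1 x' -> face C w x' -> False.
  move=> w0 Gx fx /T1P[Tx' nGx'] fx'.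
  have xx' : x != x' by apply/eqP => e; apply: nGx'; rewrite -e.
  have fm : face C w (2^-1 *: (x + x')).
    split; first exact: (spans_midpoint hN sC fx.1 fx'.1).
    by move=> c Cc; have := fx.2 _ Cc; have := fx'.2 _ Cc; rewrite !dotE; lra.
  have [s [v [[Ts v0 _ fvm fvs] _]]] := face_partner hN d0 sT w0 fm.
  have [a vE] := face_midpoint xx' w0 fx fx' fvm.
  have [a0|a0|a0] := ltrgtP a 0.
  - have fm' : face C (- w) (2^-1 *: (x + x')).
      have -> : - w = (- a^-1) *: v.
        by rewrite vE scalerA mulNr mulVf ?lt_eqF// scaleN1r.
      by apply: faceZ => //; rewrite oppr_ge0 invr_le0 ltW.
    by move: w0; rewrite (anti _ _ fm fm') eqxx.
  - have fs : face C (- w) s.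
      have -> : - w = a^-1 *: (- v).
        by rewrite vE scalerN scalerA mulVf ?gt_eqF// scale1r.
      by apply: faceZ => //; rewrite invr_ge0 ltW.
    have xs := opd _ _ _ w0 fx fs; have x's := opd _ _ _ w0 fx' fs.
    have Gs : G i0 s by apply: (either x' s).
    exact: (notboth x s i0).
  - by move: v0; rewrite vE a0 scale0r eqxx.
have nu0 : - u != 0 by rewrite oppr_eq0.
(* Either two points of the same kind lie on opposite faces and form a diametral pair, or two points
   of different kinds share a face. *)
case: Xu => [[x Gx fx]|[x T1x fx]]; case: Xu' => [[x' Gx' fx']|[x' T1x' fx']].
- exact: (notboth x x' i0 (opd _ _ _ u0 fx fx')).
- by rewrite opprK in fx'; exact: (same u x x').
- exact: (same (- u) x' x).
- rewrite opprK in fx'; have [Tx nGx] := T1P _ T1x; have [Tx' nGx'] := T1P _ T1x'.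
  by apply: nGx; apply: (either x' x) => //; exact: opd fx' fx.
Qed.

End OddLowerBound.

(** * Characterization of Reuleaux polygons *)

Section NormalCones.
Context {R : realType}.
Local Notation V := 'rV[R]_2.
Implicit Types (u v w x y z : V) (C : set V).

(* [u] is an interior point of the cone of normals to [C] at [z]. *)
Definition interior_normal C u z :=
  forall w, exists2 e : R, 0 < e & face C (u + e *: w) z.

Lemma interior_normal_comb C v v' z (a b : R) : det v v' != 0 -> 0 < a -> 0 < b ->
  face C v z -> face C v' z -> interior_normal C (a *: v + b *: v') z.
Proof.
move=> D a0 b0 fv fv' w.
have [c1 [c2 wE]] : exists c1 c2, w = c1 *: v + c2 *: v'.
  exists (det w v' / det v v'), (det v w / det v v').
  apply: (@scalerI _ _ (det v v')) => //.
  by rewrite cramer scalerDr !scalerA !(mulrC (det v v')) !divfK.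
have p1 : 0 < `|c1| + 1 by rewrite ltr_wpDl.
have p2 : 0 < `|c2| + 1 by rewrite ltr_wpDl.
pose e := Num.min (a / (`|c1| + 1)) (b / (`|c2| + 1)).
have e0 : 0 < e by rewrite lt_min !divr_gt0.
have e1 : e * (`|c1| + 1) <= a by rewrite -ler_pdivlMr// ge_min lexx.
have e2 : e * (`|c2| + 1) <= b by rewrite -ler_pdivlMr// ge_min lexx orbT.
exists e => //.
have -> : a *: v + b *: v' + e *: w = (a + e * c1) *: v + (b + e * c2) *: v'.
  by rewrite wE; apply: plane_eq; rewrite !mxE; ring.
have lb c : - (e * `|c|) <= e * c.
  by rewrite -mulrN ler_pM2l// lerNl -normrN ler_norm.
by apply: faceD => //; [have := lb c1|have := lb c2]; lra.
Qed.

(** Turning [u] slightly towards [x - z] would favour [x] over [z]. *)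
Lemma interior_normal_face C u z x : interior_normal C u z -> face C u x -> x = z.
Proof.
move=> iz fx; apply/eqP; apply: contraT => xz.
have [e e0 [Cz /(_ _ fx.1)]] := iz (x - z).
have := fx.2 _ Cz; have xz0 : x - z != 0 by rewrite subr_eq0.
by have := mulr_gt0 e0 (dot_gt0 xz0); rewrite !dotE; lra.
Qed.

End NormalCones.

Section ReuleauxPolygons.
Context {R : realType} {N : 'rV[R]_2 -> R} (hN : is_norm N).
Local Notation V := 'rV[R]_2.
Implicit Types (u v w x y z c o p q m : V).
Context {C : set V} {d : R} (d0 : 0 < d) (sC : spans N d C C) (dC : diam N C = d).

Let C0 : C !=set0.
Proof. by apply: (@diam_nonempty _ N); rewrite dC. Qed.

Let face_nonempty u : exists x, face C u x.
Proof. by have [x Cx hx] := compact_argmax u C0 (spans_compact sC); exists x. Qed.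

Lemma norming_faces x y : C x -> C y -> N (x - y) = d ->
  exists v, [/\ v != 0, face C v x & face C (- v) y].
Proof.
move=> Cx Cy xy; have [v [hv hvx]] := norming_functional hN (x - y).
rewrite xy in hvx; exists v; split.
- apply/eqP => v0; move: hvx; rewrite v0 /dot !mxE !mul0r addr0.
  by move=> e; move: d0; rewrite -e ltxx.
- split=> // c Cc; have := hv (c - y); have := spans_diam sC Cc Cy.
  by move: hvx; rewrite !dotE; lra.
- split=> // c Cc; have := hv (x - c); have := spans_diam sC Cx Cc.
  by move: hvx; rewrite !dotE; lra.
Qed.

(** The point is the centroid of the ends of two nonparallel segments in [C]; a normal there is
    constant on both, hence zero. *)
Lemma interior_point : exists2 o, C o & forall v, face C v o -> v = 0.
Proof.
have [a [b [Ca Cb ab]]] := diam_attained hN (spans_compact sC) C0.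
have ba0 : b - a != 0.
  rewrite subr_eq0; apply/eqP => e; move: d0.
  by rewrite -dC -ab e subrr (norm0 hN) ltxx.
have [u0 uba] : exists2 u, u != 0 & dot u (b - a) = 0.
  exists (\row_i if i == 0 then - (b - a) 0 1 else (b - a) 0 0).
    apply: contra_neq ba0 => /rowP h; apply: plane_eq.
      by have := h 1; rewrite !mxE.
    by have := h 0; rewrite !mxE /= => /eqP; rewrite oppr_eq0 => /eqP.
  by rewrite /dot !mxE /=; ring.
move=> u0n.
have [x fx] := face_nonempty u0; have [y fy] := face_nonempty (- u0).
have xy : dot u0 (x - y) != 0.
  apply/eqP => e; move/eqP: uba; apply; apply: (face_antipodal hN d0 sC dC fx).
  split=> [|c Cc]; first exact: fx.1.
  by have := fy.2 _ Cc; move: e; rewrite !dotE; lra.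
have Cab := spans_midpoint hN sC Ca Cb; have Cxy := spans_midpoint hN sC fx.1 fy.1.
exists (2^-1 *: (2^-1 *: (a + b) + 2^-1 *: (x + y))).
  exact: (spans_midpoint hN sC).
move=> v [_ hv].
have := hv _ Ca; have := hv _ Cb; have := hv _ fx.1; have := hv _ fy.1.
rewrite !dotE => h1 h2 h3 h4.
have e1 : dot v (b - a) = 0 by rewrite !dotE; lra.
have e2 : dot v (x - y) = 0 by rewrite !dotE; lra.
apply/eqP; apply: contraT => v0.
have D := det_of_perp2 v0 e1 e2.
have [k kE] := det_eq0 ba0 D.
by move: xy; rewrite kE dotZr u0n mulr0 eqxx.
Qed.

(** [x] is the last point of [C] on the ray from [o] through [z]. It has a partner at distance [d],
    since otherwise the ray would stay in [C] longer, and the norming functional of the pair is a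
    normal. *)
Lemma exit_point o z : C o -> (forall v, face C v o -> v = 0) -> z != o ->
  exists x v (k : R), [/\ v != 0, face C v x, 0 < k & z = o + k *: (x - o)].
Proof.
move=> Co oint zo; have Nz : 0 < N (z - o) by rewrite (norm_gt0 hN)// subr_eq0.
pose E : set R := [set t | C (o + t *: (z - o))].
have E0 : E 0 by rewrite /E /= scale0r addr0.
have hE : has_ubound E.
  exists (d / N (z - o)) => t Et; rewrite ler_pdivlMr//.
  have := spans_diam sC Et Co; rewrite (addrC o) addrK (normZ hN).
  by apply: le_trans; apply: ler_wpM2r; [exact: ltW|exact: ler_norm].
have leE t : E t -> t <= sup E by move=> Et; exact: ub_le_sup.
have e0 : 0 <= sup E by exact: leE.
set e := sup E in leE e0; pose x := o + e *: (z - o).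
have Cx : C x.
  apply: (spans_absorb sC) => c Cc; apply/ler_addgt0Pr => f f0.
  have [|t Et et] := @sup_adherent _ E (f / N (z - o)) _ (conj (ex_intro _ 0 E0) hE).
    exact: divr_gt0.
  have := norm_triangle hN (o + t *: (z - o)) x c; have := spans_diam sC Et Cc.
  have -> : x - (o + t *: (z - o)) = (e - t) *: (z - o).
    by rewrite /x; apply: plane_eq; rewrite !mxE; ring.
  have te : 0 <= e - t by rewrite subr_ge0 leE.
  rewrite (normZ_ge0 hN _ te).
  have : (e - t) * N (z - o) <= f by rewrite -ler_pdivlMr// -/e in et *; lra.
  lra.
have [c Cc xc] := compact_max C0 (spans_compact sC) (@continuous_normB _ _ hN x).
have xcd : N (x - c) = d.
  apply/le_anti; rewrite (spans_diam sC Cx Cc)/= leNgt; apply/negP => lt.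
  have f0 : 0 < (d - N (x - c)) / N (z - o) by rewrite divr_gt0// subr_gt0.
  suff /leE : E (e + (d - N (x - c)) / N (z - o)) by lra.
  apply: (spans_absorb sC) => b Cb; have := xc _ Cb; rewrite !(normB hN _ x) => xb.
  have -> : o + (e + (d - N (x - c)) / N (z - o)) *: (z - o) - b
      = (x - b) + ((d - N (x - c)) / N (z - o)) *: (z - o).
    by rewrite /x; apply: plane_eq; rewrite !mxE; ring.
  apply: le_trans (normD hN _ _) _; rewrite (normZ_ge0 hN _ (ltW f0)).
  by rewrite divfK ?gt_eqF//; lra.
have [v [v0 fx _]] := norming_faces Cx Cc xcd.
have ep : 0 < e.
  rewrite lt_def e0 andbT; apply/eqP => ez; move/eqP: v0; apply; apply: oint.
  by move: fx; rewrite /x ez scale0r addr0.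
exists x, v, e^-1; split=> //; first by rewrite invr_gt0.
by rewrite /x (addrC o (e *: _)) addrK scalerA mulVf ?gt_eqF// scale1r subrKC.
Qed.

(** The two kinds of boundary points of a Reuleaux polygon: on an arc centred at a point of [P], or
    a vertex in [P]. *)
Definition good (P : set V) u := (exists2 p, P p & face C (- u) p) \/
  (exists2 p, P p & interior_normal C u p).

(** For [z] outside [C] within [d] of [P], constant width excludes the first alternative at the exit
    point [x] towards [z]. So every nonzero normal of [x] is interior to its normal cone, which
    fails at the last normal given by [face_last]. *)
Lemma good_reuleaux (P : set V) : complete_body N C -> finite_set P -> P `<=` C ->
  (forall u, u != 0 -> good P u) -> reuleaux_polygon N C.
Proof.
move=> cC finP PC gP; split; rewrite ?dC//; exists P; split=> //.
have d0' : d != 0 by rewrite gt_eqF.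
apply/seteqP; split=> [c Cc p Pp|z hz].
  exists (d^-1 *: (c - p)); last by rewrite scalerA divff// scale1r subrKC.
  rewrite /unit_ball /= (normZ_ge0 hN); last by rewrite invr_ge0 ltW.
  by rewrite ler_pdivrMl// mulr1; apply: (spans_diam sC) => //; exact: PC.
have {}hz p : P p -> N (z - p) <= d.
  move=> /hz[b]; rewrite /unit_ball /= => Nb <-.
  rewrite (addrC p) addrK (normZ_ge0 hN _ (ltW d0)) -{2}(mulr1 d).
  by rewrite ler_pM2l.
apply: contrapT => nCz; have [ o Co oint] := interior_point.
have zo : z != o by apply/eqP => zo; apply: nCz; rewrite zo.
have [x [v [k [v0 fx k0 zE]]]] := exit_point Co oint zo.
have k1 : 1 < k.
  rewrite ltNge; apply/negP => k1; apply: nCz; rewrite zE.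
  have -> : o + k *: (x - o) = k *: x + (1 - k) *: o.
    by apply: plane_eq; rewrite !mxE; ring.
  apply: (spans_convex hN sC) => //; [exact: ltW|by rewrite subr_ge0|by rewrite addrC subrK|exact: fx.1].
have inter u : u != 0 -> face C u x -> interior_normal C u x.
  move=> u0 fux.
  have uz : dot u x < dot u z.
    have : dot u o < dot u x.
      rewrite lt_neqAle (fux.2 _ Co) andbT; apply/eqP => e.
      by move/eqP: u0; apply; apply: oint; split=> // c; rewrite e; exact: fux.2.
    have kk : 0 < k - 1 by lra.
    move=> h; have := mulr_gt0 kk (_ : 0 < dot u x - dot u o).
    by rewrite subr_gt0 => /(_ h); rewrite zE !dotE; lra.
  have [[p Pp fp]|[p Pp ip]] := gP _ u0.
    have := opposite_faces hN d0 sC dC fux fp (hz _ Pp).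
    by move: uz; rewrite !dotE; lra.
  by rewrite (interior_normal_face ip fux).
have [w Dw nw] : exists2 w, det v w != 0 & ~ face C w x.
  have [w Dw] := exists_det_gt0 v0.
  have [fw|nw] := pselect (face C w x); last by exists w; rewrite ?gt_eqF.
  exists (- w); first by rewrite detNr oppr_eq0 gt_eqF.
  move=> fw'; have w0 := face_antipodal hN d0 sC dC fw fw'.
  by move: Dw; rewrite w0 /det !mxE !mulr0 subrr ltxx.
have [e [e0 fe he]] := face_last fx nw.
have ve0 : v + e *: w != 0.
  by apply: (@det_neq0l _ _ w); rewrite !detE; move: Dw; rewrite mulr0 addr0.
have [f f0 ff] := inter _ ve0 fe w.
by apply: (he (e + f)); [lra|rewrite scalerDl addrA].
Qed.

Lemma goodZ P u (a : R) : 0 < a -> good P (a *: u) -> good P u.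
Proof.
move=> a0 [[p Pp fp]|[p Pp ip]]; [left|right]; exists p => //.
  have -> : - u = a^-1 *: - (a *: u) by rewrite scalerN scalerA mulVf ?gt_eqF// scale1r.
  by apply: faceZ => //; rewrite invr_ge0 ltW.
move=> w; have [e e0 fe] := ip w; exists (e / a); first exact: divr_gt0.
have -> : u + (e / a) *: w = a^-1 *: (a *: u + e *: w).
  by rewrite scalerDr !scalerA mulVf ?gt_eqF// scale1r mulrC.
by apply: faceZ => //; rewrite invr_ge0 ltW.
Qed.

Lemma goodS P Q u : P `<=` Q -> good P u -> good Q u.
Proof.
by move=> PQ [[p Pp h]|[p Pp h]]; [left|right]; exists p => //; exact: PQ.
Qed.

(** Adjacency is used on both sides of [v]: [z1] serves the directions on one side, [z2] those on
    the other, and [y], opposite to [v], serves [v] itself. *)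
Lemma good_near v :
  (forall w, det v w != 0 -> exists2 t : R, 0 < t & exists z,
    (face C v z /\ face C (v + t *: w) z) \/
    (face C (- v) z /\ face C (- (v + t *: w)) z)) -> v != 0 ->
  exists O P, [/\ open O, O v, finite_set P, P `<=` C & forall u, O u -> good P u].
Proof.
move=> adj v0; have [w Dw] := exists_det_gt0 v0.
have [|t1 t10 [z1 hz1]] := adj w; first by rewrite gt_eqF.
have [|t2 t20 [z2 hz2]] := adj (- w); first by rewrite detNr oppr_eq0 gt_eqF.
have [y fy] := face_nonempty (- v).
pose P (a : V) := [set u : V | 0 < det a u].
(* The open cone between [v - t2 *: w] and [v + t1 *: w]. *)
pose O := P (- w) `&` (P (- (t1 *: w) - v) `&` P (- (t2 *: w) + v)).
have opn a : open (P a).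
  apply: (@open_comp _ _ (det a) [set r | 0 < r]); last exact: open_gt.
  by move=> x _; exact: continuous_det.
have side (t : R) s z u : 0 < t -> det v s != 0 ->
    (face C v z /\ face C (v + t *: s) z) \/
    (face C (- v) z /\ face C (- (v + t *: s)) z) ->
    0 < - det s u / det v s -> 0 < det v u / det v s ->
    det v u / det v s < t * (- det s u / det v s) ->
    good [set z] u.
  move=> t0 D h; have -> : - det s u = det u s by rewrite [RHS]detC.
  set a := _ / _; set b := det v u / _ => a0 b0 bt.
  have uE : u = (a - b / t) *: v + (b / t) *: (v + t *: s).
    have -> : (a - b / t) *: v + (b / t) *: (v + t *: s) = a *: v + b *: s.
      by apply: plane_eq; rewrite !mxE; field; rewrite gt_eqF.
    apply: (@scalerI _ _ (det v s)) => //.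
    by rewrite cramer [RHS]scalerDr !scalerA !(mulrC (det v s)) !divfK.
  have abt : 0 < a - b / t by rewrite subr_gt0 ltr_pdivrMr// mulrC.
  have bt0 : 0 < b / t by exact: divr_gt0.
  case: h => -[h1 h2]; [right|left]; exists z => //; rewrite uE.
    by apply: interior_normal_comb => //; rewrite !detE add0r mulf_neq0// gt_eqF.
  rewrite opprD -(scalerN _ v) -(scalerN _ (v + _)); apply: faceD => //; exact: ltW.
have Cz1 : C z1 by case: hz1 => -[[]].
have Cz2 : C z2 by case: hz2 => -[[]].
exists O, [set z1; z2; y]; split.
- by apply: openI; [|apply: openI]; exact: opn.
- have wv : 0 < - det w v by rewrite -detC.
  by split; [|split]; rewrite /P /= !detE ?subr0 ?addr0 ?mulNr -?mulrN ?mulr_gt0.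
- by rewrite !finite_setU; do !split; exact: finite_set1.
- by move=> p [[->|->]|->] //; exact: fy.1.
move=> u [+ []]; rewrite /P /= !detE => h1 h2 h3.
have [neg|pos|z] := ltrgtP (det v u) 0.
- apply: (@goodS [set z2]); first by move=> p ->; left; right.
  have Dn : det v (- w) = - det v w by rewrite detNr.
  have Di : 0 < (det v w)^-1 by rewrite invr_gt0.
  apply: (side t2 (- w) z2 u) => //; rewrite Dn ?oppr_eq0 ?gt_eqF// ?detNl ?opprK invrN.
  + by rewrite mulrN -mulNr mulr_gt0.
  + by rewrite mulrN -mulNr mulr_gt0 ?oppr_gt0.
  + by rewrite !mulrN ltrN2 mulrA ltr_pM2r//; lra.
- apply: (@goodS [set z1]); first by move=> p ->; left; left.
  apply: (side t1 w z1 u) => //; rewrite ?gt_eqF ?divr_gt0//.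
  by rewrite mulrA ltr_pM2r ?invr_gt0//; lra.
- left; exists y; first by right.
  have [k uE] := det_eq0 v0 z; rewrite uE -scalerN; apply: faceZ => //.
  have := h1; rewrite uE detZr -mulrN -detC pmulr_lgt0//; exact: ltW.
Qed.

(** Finitely many neighbourhoods from [good_near] cover the unit circle; the union of their finite
    sets serves every direction. *)
Lemma reuleaux_of_adjacent : complete_body N C ->
  (forall v w, det v w != 0 -> exists2 t : R, 0 < t & exists z,
    (face C v z /\ face C (v + t *: w) z) \/
    (face C (- v) z /\ face C (- (v + t *: w)) z)) ->
  reuleaux_polygon N C.
Proof.
move=> cC adj.
have loc (v : V) : exists OP : set V * set V, v != 0 -> [/\ open OP.1, OP.1 v,
    finite_set OP.2, OP.2 `<=` C & forall u, OP.1 u -> good OP.2 u].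
  have [v0|nv0] := pselect (v != 0); last by exists (set0, set0).
  have [ O [P h]] := good_near (adj v) v0; by exists (O, P).
have [ OP hOP] := choice loc.
pose sph : set V := [set x | N x = 1].
have sph0 x : sph x -> x != 0.
  by move=> Nx; apply/eqP => x0; move: Nx; rewrite x0 /sph /= (norm0 hN) => /esym/eqP;
    rewrite oner_eq0.
have csph : compact sph.
  apply: (compact_norm hN); last by exists 1 => x ->.
  apply: (@preimage_closed _ _ N [set r | r = 1]); last exact: closed_eq.
  by move=> x _; exact: continuous_norm.
move: csph; rewrite compact_cover => /(_ _ sph (fun v => (OP v).1)) [||D Dsph cov].
- by move=> v /sph0/hOP[].
- by move=> v sv; exists v => //; case: (hOP v (sph0 _ sv)).
apply: (@good_reuleaux (\bigcup_(v in [set` D]) (OP v).2)) => //.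
- apply: bigcup_finite; first exact: finite_fset.
  by move=> v /Dsph/set_mem/sph0/hOP[].
- by move=> p [v /Dsph/set_mem/sph0/hOP[_ _ _ h _]] /h.
- move=> u u0; have Nu := norm_gt0 hN u0.
  have su : sph ((N u)^-1 *: u).
    by rewrite /sph /= (normZ_ge0 hN) ?invr_ge0 ?norm_ge0// mulVf ?gt_eqF.
  have [v Dv Ov] := cov _ su.
  apply: (@goodZ _ _ (N u)^-1); first by rewrite invr_gt0.
  apply: (@goodS (OP v).2); first by move=> p Pp; exists v.
  by have /set_mem/sph0/hOP[_ _ _ _] := Dsph _ Dv; apply.
Qed.

End ReuleauxPolygons.

(** * Covering by arcs *)

Section SeparatedDirections.
Context {R : realType}.
Local Notation V := 'rV[R]_2.
Implicit Types (u v w x y z : V) (C : set V) (r s t : R).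

Lemma face_between C v w z r s t : r <= s <= t -> r < t ->
  face C (v + r *: w) z -> face C (v + t *: w) z -> face C (v + s *: w) z.
Proof.
move=> /andP[rs st] rt fr ft; have tr : 0 < t - r by lra.
have -> : v + s *: w = ((t - s) / (t - r)) *: (v + r *: w)
    + ((s - r) / (t - r)) *: (v + t *: w).
  by apply: plane_eq; rewrite !mxE; field; rewrite gt_eqF.
by apply: faceD => //; rewrite divr_ge0//; lra.
Qed.

Lemma det_pencil v w s t : det (v + s *: w) (v + t *: w) = (t - s) * det v w.
Proof. by rewrite !detE (detC w v); ring. Qed.

(* If the point of [C] with normal [v + t w] had normals [v + r w] for [r]
   arbitrarily close to [0], then these points would coincide, and [v] would be
   a normal there. *)
Lemma separated_below C v w t : det v w != 0 -> 0 < t ->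
  ~ (exists z, face C v z /\ face C (v + t *: w) z) ->
  exists2 s, 0 < s < t & forall r, 0 < r <= s ->
    ~ (exists z, face C (v + r *: w) z /\ face C (v + t *: w) z).
Proof.
move=> D t0 sep; apply: contrapT => H.
have near s : 0 < s < t -> exists r z, [/\ 0 < r <= s, face C (v + r *: w) z &
    face C (v + t *: w) z].
  move=> st; apply: contrapT => H'; apply: H; exists s => // r rs [z [h1 h2]].
  by apply: H'; exists r, z.
have common s : 0 < s < t -> exists z, face C (v + s *: w) z /\ face C (v + t *: w) z.
  move=> st; have [r [z [rs fr ft]]] := near _ st; exists z; split=> //.
  by apply: face_between fr ft; lra.
have t2 : 0 < t / 2 < t by lra.
have uniq z z' s : face C (v + s *: w) z -> face C (v + t *: w) z ->
    face C (v + s *: w) z' -> face C (v + t *: w) z' -> s < t -> z = z'.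
  move=> h1 h2 h3 h4 st; apply: face_eq h1 h2 h3 h4.
  by rewrite det_pencil mulf_neq0// gt_eqF// subr_gt0.
have [z [fz fzt]] := common _ t2.
apply: sep; exists z; split=> //.
apply: (@face_limit _ _ _ w _ (t / 2)) => [|s /andP[s0 st]]; first by lra.
have [|z' [fz' fzt']] := common s; first by lra.
have fz2 : face C (v + (t / 2) *: w) z' by apply: face_between fz' fzt'; lra.
have t2' : t / 2 < t by lra.
by rewrite (uniq _ _ _ fz fzt fz2 fzt' t2').
Qed.

(** The opposites are included because the cuts are made with alternating signs. *)
Definition separated_directions C u v :=
  ~ (exists z, face C u z /\ face C v z) /\
  ~ (exists z, face C (- u) z /\ face C (- v) z).

Lemma separated_directionsC C u v :
  separated_directions C u v -> separated_directions C v u.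
Proof. by move=> [h1 h2]; split=> -[z [? ?]]; [apply: h1|apply: h2]; exists z. Qed.

(** From [t = 1] on, [separated_below] is applied to [v] and [w] and to their opposites; the smaller
    of the two parameters comes next, and all terms stay positive. *)
Lemma separated_sequence C v w : det v w != 0 ->
  (forall t, 0 < t -> separated_directions C v (v + t *: w)) ->
  exists f : nat -> R, forall n, f n.+1 < f n /\
    separated_directions C (v + f n *: w) (v + f n.+1 *: w).
Proof.
move=> D sep.
have next t : exists s, 0 < t -> 0 < s < t /\
    separated_directions C (v + t *: w) (v + s *: w).
  have [t0|t0] := ltP 0 t; last by exists 0.
  have [sep1 sep2] := sep _ t0.
  have [s1 st1 h1] := separated_below D t0 sep1.
  have D' : det (- v) (- w) != 0 by rewrite detNl detNr opprK.
  have [|s2 st2 h2] := separated_below D' t0 (C := C).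
    by rewrite scalerN -opprD.
  exists (Num.min s1 s2) => _; case/andP: st1 => s10 s1t; case/andP: st2 => s20 s2t.
  have m0 : 0 < Num.min s1 s2 by rewrite lt_min s10.
  split; first by rewrite m0 gt_min s1t.
  split=> -[z [fz1 fz2]].
    by apply: (h1 (Num.min s1 s2)); [rewrite m0 ge_min lexx|exists z].
  apply: (h2 (Num.min s1 s2)); first by rewrite m0 ge_min lexx orbT.
  by exists z; rewrite !scalerN -!opprD.
have [g hg] := choice next.
pose f n := iter n g 1.
have f0 n : 0 < f n.
  by elim: n => [|n /hg[/andP[]]//]; rewrite /f /= ltr01.
by exists f => n; have [/andP[_ ?] ?] := hg _ (f0 n).
Qed.

(** The decreasing parameters are read forwards or backwards, according to the sign of [det v w], so
    that the directions turn counterclockwise. *)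
Lemma separated_chain C v w M : det v w != 0 ->
  (forall t, 0 < t -> separated_directions C v (v + t *: w)) ->
  exists psi : nat -> V,
    (forall i j, (i < j)%N -> (j <= M)%N -> 0 < det (psi i) (psi j)) /\
    forall i, (i < M)%N -> separated_directions C (psi i) (psi i.+1).
Proof.
move=> D sep; have [f hf] := separated_sequence D sep.
have mono i j : (i < j)%N -> f j < f i.
  elim: j => // j IH; rewrite ltnS leq_eqVlt => /orP[/eqP <-|/IH h]; first exact: (hf i).1.
  exact: lt_trans (hf j).1 h.
have [Dn|Dp|/eqP] := ltrgtP (det v w) 0; last by rewrite (negPf D).
- exists (fun i => v + f i *: w); split=> [i j ij _|i _]; last exact: (hf i).2.
  by rewrite det_pencil nmulr_lgt0// subr_lt0; exact: mono.
- exists (fun i => v + f (M - i)%N *: w); split=> [i j ij jM|i iM].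
    by rewrite det_pencil pmulr_lgt0// subr_gt0; apply: mono; rewrite ltn_sub2l// (leq_trans ij).
  apply: separated_directionsC; have := (hf (M - i.+1)%N).2.
  by rewrite subnSK.
Qed.

End SeparatedDirections.

(** * Boundary arcs and the cones over them *)

Section Arcs.
Context {R : realType} {N : 'rV[R]_2 -> R} (hN : is_norm N).
Local Notation V := 'rV[R]_2.
Implicit Types (u v w x y z c o p q m : V).

(* [0 <= det p u] says that [u] lies in the half-plane counterclockwise of [p]. *)
Definition arc (C : set V) p q : set V :=
  [set x | exists u, [/\ u != 0, 0 <= det p u, 0 <= det q u & face C u x]].

(** The arc is the projection of a compact set of pairs of a point and a unit normal. *)
Lemma arc_compact C p q : compact C -> compact (arc C p q).
Proof.
move=> cC.
pose sph : set V := [set x | N x = 1].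
have csph : compact sph.
  apply: (compact_norm hN); last by exists 1 => x ->.
  apply: (@preimage_closed _ _ N [set r | r = 1]); last exact: closed_eq.
  by move=> x _; exact: continuous_norm.
have ccoord (i : 'I_2) : continuous (fun x : V => x 0 i) by exact: coord_continuous.
have c1 i : continuous (fun x : V * V => x.1 0 i).
  by move=> x; apply: (@continuous_comp _ _ _ fst (fun y : V => y 0 i));
    [exact: cvg_fst|exact: ccoord].
have c2 i : continuous (fun x : V * V => x.2 0 i).
  by move=> x; apply: (@continuous_comp _ _ _ snd (fun y : V => y 0 i));
    [exact: cvg_snd|exact: ccoord].
have cdet a : continuous (fun x : V * V => det a x.2).
  by move=> x; apply: (@continuous_comp _ _ _ snd (det a));
    [exact: cvg_snd|exact: continuous_det].
have cdot c : continuous (fun x : V * V => dot x.2 (x.1 - c)).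
  move=> x; rewrite (_ : (fun x : V * V => _) = (fun x : V * V =>
      x.2 0 0 * (x.1 0 0 - c 0 0) + x.2 0 1 * (x.1 0 1 - c 0 1))); last first.
    by apply/funext => y; rewrite /dot !mxE.
  by apply: cvgD; apply: cvgM; (try exact: c2); apply: cvgB;
    (try exact: c1); exact: cvg_cst.
have clge (f : V * V -> R) : continuous f -> closed [set x | 0 <= f x].
  move=> cf; apply: (@preimage_closed _ _ f [set r | 0 <= r]); last exact: closed_ge.
  by move=> x _; exact: cf.
pose B : set (V * V) := (C `*` sph) `&` ([set x | 0 <= det p x.2] `&`
  ([set x | 0 <= det q x.2] `&` \bigcap_(c in C) [set x | 0 <= dot x.2 (x.1 - c)])).
have -> : arc C p q = fst @` B.
  apply/seteqP; split=> [x [u [u0 pu qu fx]]|_ [[x u] [[/= Cx su] [pu [qu h]]] <-]].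
    have Nu := norm_gt0 hN u0; have Nui : 0 < (N u)^-1 by rewrite invr_gt0.
    exists (x, (N u)^-1 *: u) => //; split; first split; first exact: fx.1.
      by rewrite /sph /= (normZ_ge0 hN _ (ltW Nui)) mulVf ?gt_eqF.
    split; first by rewrite /= detZr mulr_ge0// ltW.
    split; first by rewrite /= detZr mulr_ge0// ltW.
    move=> c Cc /=; rewrite dotZl; apply: mulr_ge0; first exact: ltW.
    by have := fx.2 _ Cc; rewrite !dotE; lra.
  exists u; split=> //.
    by apply/eqP => u0; move: su; rewrite u0 /sph /= (norm0 hN) => /esym/eqP; rewrite oner_eq0.
  by split=> // c Cc; have := h _ Cc; rewrite /= !dotE; lra.
apply: continuous_compact.
  by apply: continuous_subspaceT => x; exact: cvg_fst.
apply: compact_closedI; first exact: compact_setX.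
apply: closedI; first exact: clge.
apply: closedI; first exact: clge.
by apply: closed_bigI => c _; exact: clge.
Qed.

Context {C : set V} {d : R} (d0 : 0 < d) (sC : spans N d C C) (dC : diam N C = d).

(** [u] lies between [q] and [- p] counterclockwise. By convexity of the normal cone, a normal [v]
    on the wrong side of [m] would give [x] both normals [m] and [q], or [- p] and [- m], or [v] and
    [- v]. *)
Let normals_apart p m q u v x : 0 < det p m -> 0 < det m q -> 0 < det p q ->
  ~ (exists z, face C m z /\ face C q z) ->
  ~ (exists z, face C (- p) z /\ face C (- m) z) ->
  u != 0 -> 0 <= det p u -> 0 <= det q u -> face C u x ->
  v != 0 -> face C v x -> 0 < det m v.
Proof.
move=> pm mq pq sep1 sep2 u0 pu qu fu v0 fv; rewrite ltNge; apply/negP => mv.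
have mE : det p q * det m u = det m q * det p u + det p m * det q u.
  by rewrite /det; ring.
have mu : 0 < det m u.
  have mu0 : 0 <= det m u.
    by rewrite -(pmulr_rge0 _ pq) mE addr_ge0// mulr_ge0// ltW.
  rewrite lt_def mu0 andbT; apply/eqP => z; move/eqP: u0; apply.
  have : det m q * det p u + det p m * det q u = 0 by rewrite -mE z mulr0.
  have := mulr_ge0 (ltW mq) pu; have := mulr_ge0 (ltW pm) qu => h1 h2 h3.
  have /eqP : det m q * det p u = 0 by lra.
  have /eqP : det p m * det q u = 0 by lra.
  rewrite !mulf_eq0 (gt_eqF mq) (gt_eqF pm) /= => /eqP h4 /eqP h5.
  have := cramer p q u; rewrite (detC u q) h4 h5 oppr0 !scale0r addr0.
  by move=> /eqP; rewrite scaler_eq0 gt_eqF//= => /eqP.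
have cone a b c : 0 < det a b -> 0 <= det c b -> 0 <= det a c ->
    face C a x -> face C b x -> face C c x.
  move=> D h1 h2 fa fb.
  have -> : c = (det c b / det a b) *: a + (det a c / det a b) *: b.
    apply: (@scalerI _ _ (det a b)); first by rewrite gt_eqF.
    rewrite cramer [RHS]scalerDr !scalerA.
    by rewrite !(mulrC (det a b)) !divfK// gt_eqF.
  by apply: faceD => //; apply: divr_ge0 => //; exact: ltW.
have [Dn|Dp|D] := ltrgtP (det v u) 0.
- have uv : 0 < det u v by rewrite detC oppr_gt0.
  have fm : face C (- m) x.
    by apply: (cone u v) => //; rewrite !detE; [|rewrite -detC]; lra.
  apply: sep2; exists x; split=> //.
  apply: (cone u (- m)) => //; rewrite !detE.
  + by rewrite -detC.
  + by rewrite opprK; exact: ltW.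
  + by rewrite -detC.
- have fm : face C m x.
    by apply: (cone v u) => //; [exact: ltW|rewrite detC; lra].
  apply: sep1; exists x; split=> //.
  by apply: (cone m u) => //; exact: ltW.
- have [k uE] := det_eq0 v0 D.
  have k0 : k < 0.
    rewrite ltNge; apply/negP => kp; move: mu; rewrite uE detZr.
    by have : k * det m v <= 0 by [apply: mulr_ge0_le0]; lra.
  have fv' : face C (- v) x.
    have -> : - v = (- k^-1) *: u.
      by rewrite uE scalerA mulNr mulVf ?lt_eqF// scaleN1r.
    by apply: faceZ => //; rewrite oppr_ge0 invr_le0 ltW.
  by move: v0; rewrite (face_antipodal hN d0 sC dC fv fv') eqxx.
Qed.

(** A diametral pair has opposite normals, which cannot both lie strictly counterclockwise of
    [m]. *)
Lemma arc_not_diametral p m q x y :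
  0 < det p m -> 0 < det m q -> 0 < det p q ->
  ~ (exists z, face C m z /\ face C q z) ->
  ~ (exists z, face C (- p) z /\ face C (- m) z) ->
  arc C p q x -> arc C p q y -> N (x - y) != d.
Proof.
move=> pm mq pq sep1 sep2 [u [u0 pu qu fu]] [u' [u'0 pu' qu' fu']].
apply/eqP => xy.
have [v [v0 fv fv']] := norming_faces hN d0 sC fu.1 fu'.1 xy.
have h1 := normals_apart pm mq pq sep1 sep2 u0 pu qu fu v0 fv.
have v0' : - v != 0 by rewrite oppr_eq0.
have h2 := normals_apart pm mq pq sep1 sep2 u'0 pu' qu' fu' v0' fv'.
by move: h1 h2; rewrite !detE; lra.
Qed.

Definition star o (E : set V) : set V :=
  [set z | exists (t : R) x, [/\ 0 <= t <= 1, E x & z = o + t *: (x - o)]].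

(** An interior point is at distance less than [d] from all of [C], and a difference of two points
    of the star splits as [s *: (x - y) + (t - s) *: (x - o)]. *)
Lemma diam_star o E : C o -> (forall v, face C v o -> v = 0) -> compact E ->
  E `<=` C -> (forall x y, E x -> E y -> N (x - y) != d) -> diam N (star o E) < d.
Proof.
move=> Co oint cE EC nE; have d0' := d0.
have dE : diam N E < d.
  apply: (diam_lt hN) => // x y Ex Ey.
  by rewrite lt_neqAle nE//= (spans_diam sC)//; exact: EC.
have [c Cc hc] := compact_max (ex_intro _ o Co) (spans_compact sC) (@continuous_normB _ _ hN o).
have co : N (c - o) < d.
  rewrite lt_neqAle (spans_diam sC Cc Co) andbT (normB hN); apply/eqP => oc.
  have [v [v0 fv _]] := norming_faces hN d0 sC Co Cc oc.
  by move: v0; rewrite (oint _ fv) eqxx.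
pose r := Num.max (diam N E) (N (c - o)).
have r0 : 0 <= r by rewrite le_max (norm_ge0 hN) orbT.
have rd : r < d by rewrite gt_max dE.
apply: le_lt_trans rd; apply: (diam_le r0).
have bE := norm_bounded_compact hN cE.
have aux (s t : R) x y : 0 <= s -> s <= t -> t <= 1 -> E x -> E y ->
    N ((o + t *: (x - o)) - (o + s *: (y - o))) <= r.
  move=> s0 st t1 Ex Ey.
  have -> : (o + t *: (x - o)) - (o + s *: (y - o))
      = s *: (x - y) + (t - s) *: (x - o).
    by apply: plane_eq; rewrite !mxE; ring.
  apply: le_trans (normD hN _ _) _.
  have ts : 0 <= t - s by lra.
  rewrite (normZ_ge0 hN _ s0) (normZ_ge0 hN _ ts).
  have h1 : s * N (x - y) <= s * r.
    by apply: ler_wpM2l => //; rewrite le_max le_diam.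
  have h2 : (t - s) * N (x - o) <= (t - s) * r.
    by apply: ler_wpM2l => //; rewrite le_max hc ?orbT//; exact: EC.
  have h3 : t * r <= r by rewrite ler_piMl.
  lra.
move=> _ _ [t [x [/andP[t0 t1] Ex ->]]] [s [y [/andP[s0 s1] Ey ->]]].
have [st|ts] := leP s t; first exact: aux.
by rewrite (normB hN); apply: aux => //; exact: ltW.
Qed.

Lemma star_cover o z : C o -> (forall v, face C v o -> v = 0) -> C z ->
  exists x u, [/\ u != 0, face C u x & forall E, E x -> star o E z].
Proof.
move=> Co oint Cz; have [zo|zo] := eqVneq z o.
  pose e : V := \row_i 1.
  have e0 : e != 0 by apply/eqP => /rowP/(_ 0); rewrite !mxE => /eqP; rewrite oner_eq0.
  have [x Cx hx] := compact_argmax e (ex_intro _ o Co) (spans_compact sC).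
  exists x, e; split=> // E Ex; exists 0, x; split=> //; first by rewrite lexx ler01.
  by rewrite zo scale0r addr0.
have [x [u [k [u0 fx k0 zE]]]] := exit_point hN d0 sC dC Co oint zo.
exists x, u; split=> // E Ex; exists k, x; split=> //.
rewrite ltW//= leNgt; apply/negP => k1.
have ox : dot u o < dot u x.
  rewrite lt_neqAle (fx.2 _ Co) andbT; apply/eqP => e.
  by move/eqP: u0; apply; apply: oint; split=> // c; rewrite e; exact: fx.2.
have kk : 0 < k - 1 by lra.
have xo : 0 < dot u x - dot u o by lra.
have := mulr_gt0 kk xo; have := fx.2 _ Cz; rewrite zE !dotE; lra.
Qed.

End Arcs.

(** * The upper bound 2k + 1 *)

Section OddUpperBound.
Context {R : realType}.
Local Notation V := 'rV[R]_2.

(* With [D j = det (phi j) u], these are the conditions for [u] to lie in the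
   [j]-th of the [2 k + 1] cones cut out by the directions [phi j]. *)
Definition arc_signs (k : nat) (D : nat -> R) (j : nat) : bool :=
  if j == 0%N then (D (2 * k)%N <= 0) && (0 <= D 0%N)
  else if odd j then (D j.-1 <= 0) && (D j <= 0)
  else (0 <= D j.-1) && (0 <= D j).

(* For each [i], one of the arcs [2 i + 1] and [2 i + 2] is available, unless [D]
   changes sign from positive to negative between [2 i] and [2 i + 2]; this
   happens for at most one [i], and then the arc [0] is available instead. *)
Lemma arc_signs_count k (D : nat -> R) :
  (forall a b c, (a < b)%N -> (b < c)%N -> (c <= 2 * k)%N ->
    exists r s : R, [/\ 0 < r, 0 < s & D b = r * D a + s * D c]) ->
  exists f : 'I_k -> 'I_(2 * k).+1, injective f /\ forall i, arc_signs k D (f i).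
Proof.
move=> btw.
(* By the betweenness hypothesis, a fall from positive to negative values forces positive values
   before it and, by [right], negative ones after it. *)
have left a b c : (c <= a)%N -> (a < b)%N -> (b <= 2 * k)%N -> 0 < D a -> D b < 0 ->
    0 < D c.
  rewrite leq_eqVlt => /orP[/eqP -> //|ca] ab bk Da Db.
  rewrite ltNge; apply/negP => Dc; have [r [s [r0 s0 DE]]] := btw _ _ _ ca ab bk.
  have h1 : r * D c <= 0 by rewrite pmulr_rle0.
  have h2 : s * D b < 0 by rewrite pmulr_rlt0.
  by lra.
have right a b c : (b <= c)%N -> (a < b)%N -> (c <= 2 * k)%N -> 0 < D a -> D b < 0 ->
    D c < 0.
  rewrite leq_eqVlt => /orP[/eqP <- //|bc] ab ck Da Db.
  rewrite ltNge; apply/negP => Dc; have [r [s [r0 s0 DE]]] := btw _ _ _ ab bc ck.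
  have h1 : 0 <= s * D c by rewrite pmulr_rge0.
  have h2 : 0 < r * D a by rewrite pmulr_rgt0.
  by lra.
pose odd_ok i := (D (2 * i)%N <= 0) && (D (2 * i).+1 <= 0).
pose even_ok i := (0 <= D (2 * i).+1) && (0 <= D (2 * i).+2).
have fail i : ~~ odd_ok i -> ~~ even_ok i -> exists a b,
    [/\ (2 * i <= a)%N, (a < b)%N, (b <= (2 * i).+2)%N, 0 < D a & D b < 0].
  rewrite /odd_ok /even_ok !negb_and -!ltNge => h1 h2.
  have [n|p|z] := ltrgtP (D (2 * i).+1) 0.
  - exists (2 * i)%N, (2 * i).+1; split=> //.
    by case/orP: h1 => //; lra.
  - exists (2 * i).+1, (2 * i).+2; split=> //.
    by case/orP: h2 => //; lra.
  - exists (2 * i)%N, (2 * i).+2; split=> //.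
      by case/orP: h1 => //; lra.
    by case/orP: h2 => //; lra.
pose n i := if odd_ok i then (2 * i).+1 else if even_ok i then (2 * i).+2 else 0%N.
have ik (i : 'I_k) : ((2 * i).+2 <= 2 * k)%N.
  by have := ltn_ord i; lia.
have nk (i : 'I_k) : (n i < (2 * k).+1)%N.
  by rewrite /n; case: ifP => _; [|case: ifP => _ //]; have := ik i; rewrite ltnS => // /ltnW.
exists (fun i => Ordinal (nk i)); split; last first.
  move=> i; rewrite /arc_signs /= /n.
  have [h1|h1] := boolP (odd_ok i); first by rewrite /= oddM.
  have [h2|h2] := boolP (even_ok i); first by rewrite /= oddM.
  have [a [b [ia ab bi Da Db]]] := fail _ h1 h2.
  have bk := leq_trans bi (ik i).
  by rewrite eqxx (ltW (right a b (2 * k)%N _ _ _ Da Db))// (ltW (left a b 0%N _ _ _ Da Db)).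
have clash (i j : 'I_k) : (i < j)%N -> ~~ odd_ok i -> ~~ even_ok i ->
    ~~ odd_ok j -> ~~ even_ok j -> False.
  move=> ij o1 e1 o2 e2.
  have [a [b [ia ab bi Da Db]]] := fail _ o1 e1.
  have [a' [b' [ia' ab' bi' Da' Db']]] := fail _ o2 e2.
  have : D a' < 0.
    apply: (right a b) => //; last first.
      by apply: leq_trans (ltnW ab') (leq_trans bi' (ik j)).
    by apply: leq_trans bi (leq_trans _ ia'); lia.
  by lra.
move=> i j /(congr1 val) /=; rewrite /n.
have [oi|oi] := boolP (odd_ok i); have [oj|oj] := boolP (odd_ok j).
- by move=> [] /eqP; rewrite eqn_mul2l /= => /eqP/val_inj.
- case: ifP => // _ [] /(congr1 odd); by rewrite /= !oddM.
- case: ifP => // _ [] /(congr1 odd); by rewrite /= !oddM.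
- have [ei|ei] := boolP (even_ok i); have [ej|ej] := boolP (even_ok j) => //.
    by move=> [] /eqP; rewrite eqn_mul2l /= => /eqP/val_inj.
  move=> _; apply/val_inj; have [ij|ji|//] := ltngtP i j.
    by case: (clash _ _ ij oi ei oj ej).
  by case: (clash _ _ ji oj ej oi ei).
Qed.

Context {N : V -> R} (hN : is_norm N).
Implicit Types (S C : set V).

Lemma kfold_cover_exists S C k : norm_bounded N S -> 0 < diam N S ->
  completion N S C -> ~ reuleaux_polygon N C -> (0 < k)%N ->
  exists F : 'I_(2 * k).+1 -> set V, kfold_cover N k S F.
Proof.
move=> bS d0 [[cC SC eC] _] nR k0.
have sC := complete_spans hN cC; rewrite eC in sC.
set d := diam N S in d0 sC eC *.
have [v [w [D sep]]] : exists v w, det v w != 0 /\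
    forall t, 0 < t -> separated_directions C v (v + t *: w).
  apply: contrapT => H; apply: nR; apply: (reuleaux_of_adjacent hN d0 sC eC cC).
  move=> v w D; apply: contrapT => H'; apply: H; exists v, w; split=> // t t0.
  by split=> -[z hz]; apply: H'; exists t => //; exists z; [left|right].
(* The cuts [phi] are the odd terms, from [psi 1] to [psi (4 * k + 1)]; the even terms separate
   consecutive cuts, and [psi 0] and [psi (4 * k + 2)] close up the ends. *)
have [psi [pos sepi]] := separated_chain (4 * k + 2)%N D sep.
pose phi i := psi (2 * i).+1.
(* The normals defining arc [j] run counterclockwise from [Q j] to [- P j], with the signs of
   [arc_signs]. *)
pose P (j : nat) := if j == 0%N then - phi (2 * k)%N else
  if odd j then - phi j.-1 else phi j.-1.
pose Q (j : nat) := if j == 0%N then phi 0%N else if odd j then - phi j else phi j.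
have apart (j : nat) x y : (j <= 2 * k)%N -> arc C (P j) (Q j) x ->
    arc C (P j) (Q j) y -> N (x - y) != d.
  move=> jk; case: j jk => [|j] jk.
    have M0 : (2 * (2 * k)).+1.+1 = (4 * k + 2)%N by lia.
    have pM : 0 < det (phi (2 * k)%N) (psi (4 * k + 2)%N).
      by rewrite -M0; apply: pos => //; rewrite M0.
    have sM : separated_directions C (phi (2 * k)%N) (psi (4 * k + 2)%N).
      by rewrite -M0; apply: sepi; rewrite -M0.
    have q1 : 0 < det (psi 1%N) (psi (4 * k + 2)%N) by apply: pos; rewrite // addn2.
    have q0 : 0 < det (psi 0%N) (psi (4 * k + 2)%N) by apply: pos; rewrite // addn2.
    have q01 : 0 < det (psi 0%N) (psi 1%N) by apply: pos; rewrite // addn2.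
    have p0 : 0 < det (phi 0%N) (phi (2 * k)%N).
      apply: pos; last by rewrite -M0.
      by lia.
    have s01 : separated_directions C (psi 0%N) (psi 1%N) by apply: sepi; rewrite addn2.
    apply: (@arc_not_diametral _ _ hN _ d d0 sC eC _ (- psi (4 * k + 2)%N)).
    - by rewrite /P /= !detE opprK.
    - by rewrite /Q /phi muln0 detNl -detC.
    - by rewrite /P /Q /= detNl -detC.
    (* [psi 0] lies in the cone of [- psi (4 * k + 2)] and [psi 1], so it would be a normal at [z]
       too. *)
    - move=> [z [f1 f2]]; apply: s01.1; exists z; split=> //.
      have -> : psi 0%N = (det (psi 0%N) (psi 1%N) / det (psi 1%N) (psi (4 * k + 2)%N)) *:
          (- psi (4 * k + 2)%N) + (det (psi 0%N) (psi (4 * k + 2)%N) /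
          det (psi 1%N) (psi (4 * k + 2)%N)) *: psi 1%N.
        apply: (@scalerI _ _ (det (psi 1%N) (psi (4 * k + 2)%N))); first by rewrite gt_eqF.
        rewrite cramer [RHS]scalerDr !scalerA !(mulrC (det (psi 1%N) _)) !divfK ?gt_eqF//.
        by rewrite (detC (psi 1%N) (psi 0%N)) scaleNr scalerN addrC.
      apply: faceD => //; by rewrite divr_ge0// ltW.
    - move=> [z [f1 f2]]; apply: sM.1; exists z.
      by move: f1 f2; rewrite /P /= !opprK.
  have jM : ((2 * j.+1).+1 <= 4 * k + 2)%N.
    by lia.
  have e1 : (2 * j).+2 = (2 * j.+1)%N by lia.
  have pm : 0 < det (phi j) (psi (2 * j.+1)%N).
    by apply: pos; rewrite -?e1//; rewrite e1 ltnW.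
  have mq : 0 < det (psi (2 * j.+1)%N) (phi j.+1) by exact: pos.
  have pq : 0 < det (phi j) (phi j.+1) by apply: pos => //; lia.
  have s1 : separated_directions C (phi j) (psi (2 * j.+1)%N).
    by rewrite -e1; apply: sepi; rewrite e1 ltnW.
  have s2 : separated_directions C (psi (2 * j.+1)%N) (phi j.+1) by exact: sepi.
  rewrite /P /Q /=; case: ifP => _.
    apply: (@arc_not_diametral _ _ hN _ d d0 sC eC _ (- psi (2 * j.+1)%N)).
    - by rewrite !detE opprK.
    - by rewrite !detE opprK.
    - by rewrite !detE opprK.
    - exact: s2.2.
    - by rewrite !opprK; exact: s1.1.
  apply: (@arc_not_diametral _ _ hN _ d d0 sC eC _ (psi (2 * j.+1)%N)) => //.
  - exact: s2.1.
  - exact: s1.2.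
have [ o Co oint] := interior_point hN d0 sC eC.
have arcC (j : nat) : arc C (P j) (Q j) `<=` C by move=> x [u [_ _ _ []]].
have starC (j : nat) : star o (arc C (P j) (Q j)) `<=` C.
  move=> _ [t [x [/andP[t0 t1] /arcC Cx ->]]].
  have -> : o + t *: (x - o) = t *: x + (1 - t) *: o.
    by apply: plane_eq; rewrite !mxE; ring.
  by apply: (spans_convex hN sC) => //; [rewrite subr_ge0|rewrite subrKC].
exists (fun i => S `&` star o (arc C (P i) (Q i))); split=> [i|x Sx].
  split; first by move=> x [].
  apply: le_lt_trans (diam_star hN d0 sC Co oint _ (arcC i) _).
  - apply: (diamS hN); first exact: subIsetr.
    by apply: norm_boundedS (starC i) _; exact: cC.1.
  - by apply: (arc_compact hN); exact: (spans_compact sC).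
  - by move=> x y; apply: apart; rewrite -ltnS.
have [y [u [u0 fy hE]]] := star_cover hN d0 sC eC Co oint (SC _ Sx).
(* For [a < b < c], [phi b] is a positive combination of [phi a] and [phi c]; the count then yields
   [k] arcs through [y]. *)
have [|f [finj hf]] := @arc_signs_count k (fun i => det (phi i) u).
  move=> a b c ab bc ck.
  have cM : ((2 * c).+1 <= 4 * k + 2)%N.
    by lia.
  have lt i j : (i < j)%N -> (j <= c)%N -> 0 < det (phi i) (phi j).
    move=> ij jc; apply: pos; first by lia.
    by lia.
  have ac := ltn_trans ab bc.
  have Dac := lt _ _ ac (leqnn c); have Dab := lt _ _ ab (ltnW bc).
  have Dbc := lt _ _ bc (leqnn c).
  exists (det (phi b) (phi c) / det (phi a) (phi c)), (det (phi a) (phi b) / det (phi a) (phi c)).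
  split; [exact: divr_gt0|exact: divr_gt0|].
  have Dn : det (phi a) (phi c) != 0 by rewrite gt_eqF.
  have E : det (phi a) (phi c) * det (phi b) u = det (phi b) (phi c) * det (phi a) u
      + det (phi a) (phi b) * det (phi c) u by rewrite -detZl cramer !detE.
  by apply: (mulfI Dn); rewrite E; field.
apply: (leq_card_inj finj) => i; rewrite inE; apply/mem_set; split=> //; apply: hE.
exists u; split=> //; have := hf i; rewrite /arc_signs /P /Q.
  by case: ifP => [_ /andP[]|_]; [rewrite detNl oppr_ge0|case: ifP => _ /andP[]; rewrite ?detNl ?oppr_ge0].
by case: ifP => [_ /andP[]//|_]; case: ifP => _ /andP[]; rewrite ?detNl ?oppr_ge0.
Qed.

Lemma borsuk_number_odd S k : norm_bounded N S -> 0 < diam N S ->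
  unique_completion N S -> supporting_line_property N S ->
  (forall C, completion N S C -> ~ reuleaux_polygon N C) -> (0 < k)%N ->
  is_borsuk_number N k S (2 * k + 1)%N.
Proof.
move=> bS d0 [C comp] slp nR k0; rewrite addn1; split.
  exact: (kfold_cover_exists bS d0 comp (nR _ comp) k0).
by move=> m F; exact: (kfold_cover_gt hN bS d0 comp slp k0).
Qed.

End OddUpperBound.

Theorem theorem5 (R : realType) (N : 'rV[R]_2 -> R) (hN : is_norm N)
    (S : set 'rV[R]_2) (hSb : norm_bounded N S) (hS : 0 < diam N S) :
  (~ unique_completion N S \/ ~ supporting_line_property N (closure S) ->
     forall k : nat, (0 < k)%N -> is_borsuk_number N k S (2 * k)%N) /\
  (unique_completion N S -> supporting_line_property N S ->
     (forall C : set 'rV[R]_2, completion N S C -> ~ reuleaux_polygon N C) ->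
     forall k : nat, (0 < k)%N -> is_borsuk_number N k S (2 * k + 1)%N).
Proof.
split=> [H k _|uc slp nR k k0]; first exact: borsuk_number_even.
exact: borsuk_number_odd.
Qed.
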